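(* Let $d \geq 2$ and let $P$ be a set of $n$ points in $\mathbb{R}^d$ such that no more than $s$ points of $P$ lie on any $(d-1)$-plane and no more than $t$ points of $P$ lie on any $(d-2)$-plane. Let $\alpha,\beta\in\mathbb{R}\setminus\{0\}$. Then for any $\epsilon > 0$, \[|\Pi_{\alpha,\beta}(P)| \leq O_{\epsilon,d}\Big(nt^2 + n^{(4d-3)/(2d-1)+\epsilon}\, t^{(2d-2)/(2d-1)+\epsilon} + sn\Big),\] where the implied constant depends only on $\epsilon$ and $d$.
   Context: For a finite set $P \subseteq \mathbb{R}^d$ and $\alpha,\beta \in \mathbb{R}$, define $\Pi_{\alpha,\beta}(P) = \{(p,q,r) \in P \times P \times P \mid p \cdot q = \alpha,\ p \cdot r = \beta\}$, where $\cdot$ is the standard dot product. A $k$-plane is a $k$-dimensional affine subspace of $\mathbb{R}^d$. *)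

(* Defs.v *)
From HB Require Import structures.
From mathcomp Require Import all_boot all_order all_algebra.
From mathcomp Require Import finmap.
From mathcomp Require Import all_classical all_reals all_analysis.

Set Implicit Arguments.
Unset Strict Implicit.
Unset Printing Implicit Defensive.

Import Order.TTheory GRing.Theory Num.Theory.
Local Open Scope ring_scope.

Definition dotp (R : realType) (d : nat) (p q : 'rV[R]_d) : R :=
  \sum_(i < d) p ord0 i * q ord0 i.

Definition is_plane (R : realType) (d k : nat) (A : set 'rV[R]_d) : Prop :=
  exists (a : 'rV[R]_d) (W : {vspace 'rV[R]_d}),
    \dim W = k /\ A = [set x | x - a \in W]%classic.

Definition at_most_on_planes (R : realType) (d k m : nat)
    (P : {fset 'rV[R]_d}) : Prop :=
  forall A : set 'rV[R]_d, is_plane k A ->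
    (#|` [fset x in P | x \in A]%fset | <= m)%N.

Definition dot_triples (R : realType) (d : nat) (alpha beta : R)
    (P : {fset 'rV[R]_d}) : {fset 'rV[R]_d * 'rV[R]_d * 'rV[R]_d} :=
  [fset u in (P `*` P `*` P)%fset
     | (dotp u.1.1 u.1.2 == alpha) && (dotp u.1.1 u.2 == beta)]%fset.

(* Main.v *)
Require Import Defs.
From HB Require Import structures.
From mathcomp Require Import all_boot all_order all_algebra.
From mathcomp Require Import finmap.
From mathcomp Require Import all_classical all_reals all_analysis.
From mathcomp Require Import ring lra zify.

Set Implicit Arguments.
Unset Strict Implicit.
Unset Printing Implicit Defensive.

Import Order.TTheory GRing.Theory Num.Theory.
Local Open Scope ring_scope.

(**
The number of triples is at most the sum over the points p of P of
deg_alpha(p)^2 + deg_beta(p)^2, where deg_gamma(p) counts the q in P with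
p . q = gamma.  Lift p to (p, 1) in R^(d+1) and q to the linear form
z |-> q . z - gamma z_0; as gamma <> 0, two distinct points lie on at most t
common hyperplanes, and a point lies on at most s of them.

The heart is a bound m = O~(n^d t^(d-1) / k^(2d-1)) on the number of points of
degree about k, for k between C t and 2 sqrt(n t).  Choose w ~ k^2/t and a set S
of O~(n/w) of the forms meeting every large family of the following kind: all
forms (at least w of them) strictly separating some pair of vectors (greedy
hitting set; there are polynomially many such families).  Triangulate the
arrangement of S: the cell of q gets an apex v, the ray from v through q leaves
the cell through a wall, and one recurses in that wall.  Choosing the apexes
generic makes the exit wall unique, so a simplex is determined by the wall, the
side, and a simplex inside the wall; hence there are only O(|S|^d) simplices even
if the arrangement is degenerate.  Two vertices of a simplex are not separated by
S, so fewer than w forms separate them and each simplex is crossed by O(w) forms.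
A point that shares its simplex with another point is incident to at most t forms
that do not cross it, so half of its incidences are with crossing forms, and
Kovari-Sos-Turan inside each simplex gives the bound on m.

Points with k <= C t contribute O(n t^2), those with k >= 2 sqrt(n t) contribute
O(s n) by Kovari-Sos-Turan, and the remaining dyadic ranges of k contribute
O~(n^((4d-3)/(2d-1)) t^((2d-2)/(2d-1))) each.
*)

(** * Open cones *)

Section Cones.
Variables (R : realFieldType) (V : vectType R).
Implicit Types (g : 'Hom(V, R^o)) (S : seq 'Hom(V, R^o)) (c : seq V) (q u v : V).

Definition pairing g v : R := g v.

Lemma pairingD g u v : pairing g (u + v) = pairing g u + pairing g v.
Proof. by rewrite /pairing linearD. Qed.

Lemma pairingZ g a v : pairing g (a *: v) = a * pairing g v.
Proof. by rewrite /pairing linearZ. Qed.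

Lemma pairingB g u v : pairing g (u - v) = pairing g u - pairing g v.
Proof. by rewrite /pairing linearB. Qed.

Lemma pairing0 g : pairing g 0 = 0.
Proof. by rewrite /pairing linear0. Qed.

(** A relatively open simplicial cone: zero coefficients are excluded so that a form can have one
    sign on all of it, and the empty list then covers the origin. *)
Fixpoint open_cone c q : Prop :=
  if c is v :: c' then exists2 a, 0 < a & open_cone c' (q - a *: v) else q = 0.

Definition compatible S c := forall g u v, g \in S -> u \in c -> v \in c ->
  0 <= pairing g u * pairing g v.

Lemma sgr_add_eq (a x y z : R) : 0 < a -> Num.sg y = Num.sg z -> 0 <= x * z ->
  Num.sg (a * x + y) = Num.sg (x + z).
Proof.
move=> a0 yz xz.
case: (ltrgt0P z) xz yz => [z0|z0|->] xz; last first.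
- by rewrite sgr0 => /eqP; rewrite sgr_eq0 => /eqP ->; rewrite !addr0 sgrM gtr0_sg ?mul1r.
- rewrite (ltr0_sg z0) => /eqP; rewrite sgr_cp0 => y0.
  have x0 : x <= 0 by move: xz; rewrite nmulr_lge0.
  have ax0 : a * x <= 0 by rewrite pmulr_rle0.
  by rewrite !ltr0_sg //; lra.
- rewrite (gtr0_sg z0) => /eqP; rewrite sgr_cp0 => y0.
  have x0 : 0 <= x by move: xz; rewrite pmulr_lge0.
  have ax0 : 0 <= a * x by rewrite pmulr_rge0.
  by rewrite !gtr0_sg //; lra.
Qed.

(** The generators give values of one weak sign, so changing the positive weights cannot change the
    sign of the total; unit weights serve as reference. *)
Lemma open_cone_sg g c q :
  (forall u v, u \in c -> v \in c -> 0 <= pairing g u * pairing g v) ->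
  open_cone c q -> Num.sg (pairing g q) = Num.sg (\sum_(v <- c) pairing g v).
Proof.
elim: c q => [|v c IH] q /= cc; first by move=> ->; rewrite big_nil pairing0.
case=> a a0 /IH H; rewrite big_cons.
have -> : pairing g q = a * pairing g v + pairing g (q - a *: v).
  by rewrite pairingB pairingZ; ring.
apply: sgr_add_eq => //; first by apply: H => x y xc yc; apply: cc; rewrite inE ?xc ?yc orbT.
rewrite mulr_sumr big_seq; apply: sumr_ge0 => y yc.
by apply: cc; rewrite inE ?eqxx ?yc ?orbT.
Qed.

Lemma open_cone_split g c p q : open_cone c p -> open_cone c q ->
  Num.sg (pairing g p) != Num.sg (pairing g q) ->
  exists u v, [/\ u \in c, v \in c & pairing g u * pairing g v < 0].
Proof.
move=> cp cq; apply: contra_neqP => H.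
have cc u v : u \in c -> v \in c -> 0 <= pairing g u * pairing g v.
  by move=> uc vc; rewrite leNgt; apply/negP => uv; apply: H; exists u, v.
by rewrite (open_cone_sg cc cp) (open_cone_sg cc cq).
Qed.

(** The generators lie in the closure of the face of the arrangement containing [q]: a sign can only
    degenerate to zero. *)
Lemma open_cone_vertex S c g q u : compatible S c -> open_cone c q ->
  g \in S -> u \in c ->
  0 <= pairing g u * pairing g q /\ (pairing g q = 0 -> pairing g u = 0).
Proof.
move=> cS cq gS uc; have cc v w (vc : v \in c) (wc : w \in c) := cS g v w gS vc wc.
have := open_cone_sg cc cq; set z := \sum_(v <- c) _ => qz.
have uz : pairing g u * pairing g u <= pairing g u * z.
  rewrite /z (big_rem u) //= mulrDr lerDl mulr_sumr big_seq.
  by apply: sumr_ge0 => y /mem_rem yc; apply: cc.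
have uu : 0 <= pairing g u * pairing g u by rewrite -expr2 sqr_ge0.
split.
  have uz0 : 0 <= pairing g u * z by apply: le_trans uz.
  by rewrite -sgr_ge0 sgrM qz -sgrM sgr_ge0.
move=> q0; move: qz; rewrite q0 sgr0 => /esym/eqP; rewrite sgr_eq0 => /eqP z0.
move: uz; rewrite z0 mulr0 => u0.
by apply/eqP; rewrite -sqrf_eq0 expr2; apply/eqP/le_anti; rewrite u0 uu.
Qed.

Lemma small_step (A : seq 'Hom(V, R^o)) g w x : all (fun h => pairing h w != 0) A ->
  pairing g x != 0 ->
  exists e, pairing g (w + e *: x) != 0 /\
    forall h, h \in A -> Num.sg (pairing h (w + e *: x)) = Num.sg (pairing h w).
Proof.
move=> Aw gx.
have [e0 e00 He0] : exists2 e0 : R, 0 < e0 & forall h, h \in A -> forall e : R, 0 < e < e0 ->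
    Num.sg (pairing h (w + e *: x)) = Num.sg (pairing h w).
  elim: A Aw => [|h A IH] /= => [_|/andP[hw /IH [e1 e10 H1]]]; first by exists 1.
  set M := `|pairing h w| / (1 + `|pairing h x|).
  have hw0 : 0 < `|pairing h w| by rewrite normr_gt0.
  have hx0 : 0 < 1 + `|pairing h x| by apply: ltr_wpDr.
  have M0 : 0 < M by apply: divr_gt0.
  exists (Order.min e1 M); first by rewrite lt_min e10.
  move=> h'; rewrite inE => /orP[/eqP -> e|h'A e]; rewrite lt_min => /andP[e_gt0 /andP[ee1 eM]].
    rewrite pairingD pairingZ.
    have ex : `|e * pairing h x| < `|pairing h w|.
      rewrite normrM gtr0_norm //.
      have : e * (1 + `|pairing h x|) < `|pairing h w| by rewrite -ltr_pdivlMr.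
      by lra.
    case: (ltrgt0P (pairing h w)) hw ex => [h0|h0|->] // _; rewrite ltr_norml.
      by move=> /andP[? ?]; rewrite (gtr0_sg h0) gtr0_sg //; lra.
    by move=> /andP[? ?]; rewrite (ltr0_sg h0) ltr0_sg //; lra.
  by apply: H1; rewrite // e_gt0.
have h2 : 0 < e0 / 2 < e0 by apply/andP; split; lra.
have h3 : 0 < e0 / 3 < e0 by apply/andP; split; lra.
(* [g] is affine and nonconstant along [x], so it vanishes for at most one of the two trial
   steps. *)
case: (eqVneq (pairing g (w + (e0 / 2) *: x)) 0) => [g2|g2]; last first.
  by exists (e0 / 2); split=> // h hA; apply: He0.
exists (e0 / 3); split; last by move=> h hA; apply: He0.
apply: contra_neq gx => g3; move: g2 g3; rewrite !pairingD !pairingZ => g2 g3.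
have : (e0 / 2 - e0 / 3) * pairing g x = 0 by lra.
by move/eqP; rewrite mulf_eq0 => /orP[/eqP|/eqP //]; lra.
Qed.

(** The forms of [G] are made nonzero one at a time; each one treated joins [A], so later steps
    preserve its sign. *)
Lemma generic_perturbation (W : {vspace V}) (G A : seq 'Hom(V, R^o)) w :
  w \in W -> all (fun h => pairing h w != 0) A ->
  (forall g, g \in G -> exists2 x, x \in W & pairing g x != 0) ->
  exists2 v, v \in W & (forall g, g \in G -> pairing g v != 0) /\
     forall h, h \in A -> Num.sg (pairing h v) = Num.sg (pairing h w).
Proof.
elim: G A w => [|g G IH] A w wW Aw HG; first by exists w.
have [x xW gx] := HG g (mem_head _ _).
have [e [ge sAe]] := small_step Aw gx.
have wW' : w + e *: x \in W by rewrite memvD // memvZ.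
have Aw' : all (fun h => pairing h (w + e *: x) != 0) (g :: A).
  rewrite /= ge; apply/allP => h hA; have := allP Aw h hA.
  by rewrite -[in X in _ -> X]sgr_eq0 sAe // sgr_eq0.
have [//|v vW [vG vA]] := IH _ _ wW' Aw'.
  by move=> h hG; apply: HG; rewrite inE hG orbT.
exists v => //; split=> [h|h hA]; last by rewrite vA ?sAe // inE hA orbT.
rewrite inE => /orP[/eqP ->|]; last exact: vG.
by rewrite -sgr_eq0 vA ?mem_head // sgr_eq0.
Qed.

Lemma seq_argmin (T : eqType) (F : T -> R) (s : seq T) x0 : x0 \in s ->
  exists2 x, x \in s & forall y, y \in s -> F x <= F y.
Proof.
case: s => // a s _; elim: s a => [|b s IH] a.
  by exists a; rewrite ?mem_head // => y; rewrite inE => /eqP ->.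
have [x xs Hx] := IH b.
have [ax|xa] := leP (F a) (F x).
  exists a; rewrite ?mem_head // => y; rewrite inE => /orP[/eqP ->//|/Hx].
  exact: le_trans.
exists x; first by rewrite inE xs orbT.
by move=> y; rewrite inE => /orP[/eqP ->|/Hx //]; apply: ltW.
Qed.

End Cones.

(** * Triangulating a central arrangement *)

Section Triangulation.
Variables (R : realFieldType) (V : vectType R).
Variable S : seq 'Hom(V, R^o).
Hypothesis S_span : forall x, (forall g, g \in S -> pairing g x = 0) -> x = 0.
Implicit Types (g h : 'Hom(V, R^o)) (c : seq V) (q u v : V) (W : {vspace V}).

Definition signs q : seq R := [seq Num.sg (pairing g q) | g <- S].

Lemma signsP p q : signs p = signs q <->
  forall g, g \in S -> Num.sg (pairing g p) = Num.sg (pairing g q).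
Proof.
by rewrite /signs; split => [/eq_in_map //|H]; apply/eq_in_map.
Qed.

Lemma line_chains W : (\dim W <= 1)%N -> exists L : seq (seq V),
  [/\ (size L <= 3)%N, (forall c, c \in L -> (size c <= 1)%N /\ compatible S c) &
      forall q, q \in W -> exists2 c, c \in L & open_cone c q].
Proof.
move=> dW; set u := vpick W.
exists [:: [::]; [:: u]; [:: - u]]; split=> //.
  have one a : compatible S [:: a].
    by move=> g x y _; rewrite !inE => /eqP -> /eqP ->; rewrite -expr2 sqr_ge0.
  by move=> c; rewrite !inE => /or3P[] /eqP ->; split=> //; apply: one.
have WE : W = <[u]>%VS.
  have [W0|W0] := eqVneq W 0%VS.
    have -> : u = 0 by apply/eqP; rewrite /u vpick0 W0.
    by rewrite W0; apply/vspaceP => x; rewrite memv0.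
  apply/esym/eqP; rewrite eqEdim -memvE memv_pick /= dim_vline vpick0 W0.
  exact: dW.
move=> q; rewrite WE => /vlineP [a ->].
case: (ltrgt0P a) => a0.
- exists [:: u]; rewrite ?inE ?eqxx ?orbT //=; exists a => //.
  by rewrite subrr.
- exists [:: - u]; rewrite ?inE ?eqxx ?orbT //=; exists (- a); first by lra.
  by rewrite scaleNr scalerN opprK subrr.
- by exists [::]; rewrite ?inE ?eqxx ?orbT //= a0 scale0r.
Qed.

(** [q] lies in an open cell of the arrangement induced on [W], where forms vanishing on all of [W]
    induce no wall. *)
Definition off_walls W q := forall g, g \in S -> pairing g q = 0 ->
  forall x, x \in W -> pairing g x = 0.

(* The apex [v0 q] depends only on the cell of [q]; the last clause says that two walls
   hit simultaneously by the ray from [v0 q] through [q] have the same trace on [W]. *)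
Lemma generic_apexes W (Q : seq V) : exists v0 : V -> V,
  forall q, q \in Q -> q \in W -> off_walls W q ->
  [/\ v0 q \in W, signs (v0 q) = signs q,
      (forall p, signs p = signs q -> v0 p = v0 q) &
      forall g h, g \in S -> h \in S ->
        pairing g q * pairing h (v0 q) = pairing h q * pairing g (v0 q) ->
        forall x, x \in W -> pairing g q * pairing h x = pairing h q * pairing g x].
Proof.
(* Indexing by the sign vector instead of the point gives all points of one cell the same apex. *)
pose good (s : seq R) v := [/\ v \in W, signs v = s & forall q, q \in Q -> q \in W ->
  signs q = s -> forall g h, g \in S -> h \in S ->
        pairing g q * pairing h v = pairing h q * pairing g v ->
        forall x, x \in W -> pairing g q * pairing h x = pairing h q * pairing g x].
have ex s : exists v, forall w, w \in W -> off_walls W w -> signs w = s -> good s v.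
  case: (pselect (exists w, [/\ w \in W, off_walls W w & signs w = s])); last first.
    by move=> H; exists 0 => w *; case: H; exists w.
  case=> w [wW ow ws].
  (* The minor vanishes at [v] when the ray from [v] through [q] meets the walls of [g] and [h] at
     once; it suffices to avoid the finitely many minors that are not identically zero on [W]. *)
  pose minor q g h : 'Hom(V, R^o) := pairing g q *: h - pairing h q *: g.
  have minorE q g h x : pairing (minor q g h) x = pairing g q * pairing h x - pairing h q * pairing g x.
    by rewrite /pairing /minor add_lfunE opp_lfunE !scale_lfunE.
  pose G := [seq f <- [seq minor q gh.1 gh.2 | q <- Q, gh <- [seq (g, h) | g <- S, h <- S]]
      | ~~ (W <= lker f)%VS].
  pose A := [seq g <- S | pairing g w != 0].
  have Aw : all (fun h => pairing h w != 0) A by apply: filter_all.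
  have [|v vW [vG vA]] := @generic_perturbation R V W G A w wW Aw.
    move=> g; rewrite mem_filter => /andP[/subvPn [x xW xk] _]; exists x => //.
    by move: xk; rewrite memv_ker.
  exists v => w' w'W ow' _; split=> //.
    rewrite -ws; apply/signsP => g gS.
    have [gw0|gw] := eqVneq (pairing g w) 0; last by rewrite vA // mem_filter gw.
    by rewrite gw0 (ow g gS gw0 v vW).
  move=> q qQ qW qs g h gS hS E x xW; apply/eqP; rewrite -subr_eq0 -minorE.
  have [Wk|Wk] := boolP (W <= lker (minor q g h))%VS.
    by have := subvP Wk _ xW; rewrite memv_ker.
  have : minor q g h \in G.
    rewrite mem_filter Wk /=; apply/allpairsP; exists (q, (g, h)); split=> //=.
    by apply/allpairsP; exists (g, h).
  by move=> /vG; rewrite minorE E subrr eqxx.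
have [v0 Hv0] := choice ex.
exists (fun q => v0 (signs q)) => q qQ qW oq.
have [vW vs Hv] := Hv0 _ _ qW oq erefl.
by split=> //; [move=> p -> | apply: Hv].
Qed.

Lemma size_flatten_map_leq (T U : eqType) (F : T -> seq U) (B : nat) (s : seq T) :
  (forall x, x \in s -> (size (F x) <= B)%N) ->
  (size (flatten [seq F x | x <- s]) <= size s * B)%N.
Proof.
elim: s => // a s IH H; rewrite /= size_cat mulSn leq_add ?H ?mem_head ?IH //.
by move=> x xs; apply: H; rewrite inE xs orbT.
Qed.

(** Induction on the dimension. Each wall contributes its own cones and, for each of them and each
    side, at most one cone with an added apex, hence a factor 3 per wall. Only a finite [Q] is
    covered, because genericity is arranged for finitely many points; the recursive calls add the
    exit points to it. *)
Lemma chains k W (Q : seq V) : (0 < size S)%N -> (\dim W <= k.+1)%N ->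
  exists L : seq (seq V), [/\ (size L <= 3 * (3 * size S) ^ k)%N,
    (forall c, c \in L -> (size c <= k.+1)%N /\ compatible S c) &
    forall q, q \in Q -> q \in W -> exists2 c, c \in L & open_cone c q].
Proof.
move=> S0; elim: k W Q => [|k IH] W Q dW.
  by have [L [L1 L2 L3]] := line_chains dW; exists L; split=> // q _; apply: L3.
have s3 : (3 * (3 * size S) ^ k <= 3 * (3 * size S) ^ k.+1)%N.
  by rewrite leq_pmul2l // leq_exp2l //; lia.
have [dW'|dW'] := leqP (\dim W) k.+1.
  have [L [L1 L2 L3]] := IH _ Q dW'; exists L; split=> //; first exact: leq_trans s3.
  by move=> c /L2 [c1 c2]; split=> //; apply: leqW.
have [v0 Hv0] := generic_apexes W Q.
(* Central projection from the apex onto the wall of [h]; for the exit wall it represents the exit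
   point. *)
pose prj h q := q - (pairing h q / pairing h (v0 q)) *: v0 q.
pose good c := (size c <= k.+1)%N /\ compatible S c.
have exL h : exists L : seq (seq V), (exists2 x, x \in W & pairing h x != 0) ->
   [/\ (size L <= 3 * (3 * size S) ^ k)%N, (forall c, c \in L -> good c) &
    forall q, q \in Q ++ [seq prj h q | q <- Q] -> q \in (W :&: lker h)%VS ->
      exists2 c, c \in L & open_cone c q].
  case: (pselect (exists2 x, x \in W & pairing h x != 0)); last by exists [::].
  case=> x xW hx.
  have dWh : (\dim (W :&: lker h) <= k.+1)%N.
    rewrite -ltnS; apply: leq_trans dW.
    rewrite ltn_neqAle dimvS ?capvSl // andbT; apply: contra hx => /eqP E.
    have /eqP WE : (W :&: lker h)%VS == W by rewrite eqEdim capvSl E leqnn.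
    by move: xW; rewrite -WE memv_cap memv_ker => /andP[].
  by have [L HL] := IH _ (Q ++ [seq prj h q | q <- Q]) dWh; exists L.
have [Lf HLf] := choice exL.
(* [h] is reached first: no form takes the opposite sign at the exit point. *)
pose hit h q := pairing h q != 0 /\ forall g, g \in S ->
  pairing g (prj h q) = 0 \/ Num.sg (pairing g (prj h q)) = Num.sg (pairing g q).
have sgv q : q \in Q -> q \in W -> off_walls W q -> forall g, g \in S ->
    Num.sg (pairing g (v0 q)) = Num.sg (pairing g q).
  by move=> qQ qW oq; have [_ /signsP] := Hv0 _ qQ qW oq.
have ex_hit q : q \in Q -> q \in W -> off_walls W q -> exists2 h, h \in S & hit h q.
  move=> qQ qW oq; have sv := sgv _ qQ qW oq.
  have [g0 g0S g0q] : exists2 g, g \in S & pairing g q != 0.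
    apply: contrapT => H.
    (* Otherwise every form of [S] vanishes on [W], contradicting [S_span] because [W] is
       nonzero. *)
    have : vpick W != 0 by rewrite vpick0 -dimv_eq0; case: (\dim W) dW'.
    case/eqP; apply: S_span => g gS; apply: (oq g gS _ _ (memv_pick W)).
    by apply/eqP; apply: contrapT => /negP gq; apply: H; exists g.
  have g0S' : g0 \in [seq g <- S | pairing g q != 0] by rewrite mem_filter g0q.
  (* The ratio is the multiple of the apex that can be subtracted from [q] before [g] vanishes; the
     exit wall minimizes it. *)
  have [h] := seq_argmin (fun g => pairing g q / pairing g (v0 q)) g0S'.
  rewrite mem_filter => /andP[hq hS] hmin; exists h => //; split=> // g gS.
  have [gq0|gq] := eqVneq (pairing g q) 0.
    have := sv g gS; rewrite gq0 sgr0 => /eqP; rewrite sgr_eq0 => /eqP gv0.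
    by left; rewrite pairingB pairingZ gq0 gv0 mulr0 subr0.
  have gv : pairing g (v0 q) != 0 by rewrite -sgr_eq0 sv // sgr_eq0.
  have := hmin g; rewrite mem_filter gq gS => /(_ isT).
  set l := pairing h q / _ => lg.
  have -> : pairing g (prj h q) = (pairing g q / pairing g (v0 q) - l) * pairing g (v0 q).
    by rewrite pairingB pairingZ -/l mulrBl divfK.
  move: lg; rewrite le_eqVlt => /predU1P[<-|lg]; first by left; rewrite subrr mul0r.
  by right; rewrite sgrM gtr0_sg ?subr_gt0 // mul1r sv.
(* The key (exit wall, simplex of the exit point in that wall, side of the wall)
   determines the signs of [q] on [S], hence its apex. *)
pose key h c b q := [/\ q \in Q, q \in W, off_walls W q & hit h q /\
  open_cone c (prj h q) /\ (0 < pairing h q) = b].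
(* Points with one key share apex and simplex, so a single cone serves them all; a key that no point
   has gets the empty list. *)
have exo (k' : 'Hom(V, R^o) * (seq V * bool)) : exists o : seq (seq V),
    k'.1 \in S -> good k'.2.1 -> [/\ (size o <= 1)%N,
     (forall c, c \in o -> (size c <= k.+2)%N /\ compatible S c) &
     forall q, key k'.1 k'.2.1 k'.2.2 q -> exists2 c, c \in o & open_cone c q].
  case: k' => h [c b] /=.
  case: (pselect (exists q, key h c b q)); last first.
    by move=> H; exists [::] => _ _; split=> // q kq; case: H; exists q.
  case=> q [qQ qW oq [[hq hit_q] [cq bq]]]; exists [:: v0 q :: c] => hS [sc cc].
  have [vW /signsP sv v_eq v_gen] := Hv0 _ qQ qW oq.
  split=> // [c'|p [pQ pW op [[hp hit_p] [cp bp]]]].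
    rewrite inE => /eqP ->; split=> // g.
    have H u : g \in S -> u \in c -> 0 <= pairing g (v0 q) * pairing g u.
      move=> gS uc; have [uq uq0] := open_cone_vertex cc cq gS uc.
      case: (hit_q g gS) => [/uq0 ->|E]; first by rewrite mulr0.
      by rewrite mulrC -sgr_ge0 sgrM sv // -E -sgrM sgr_ge0.
    move=> u v gS; rewrite !inE => /predU1P[->|uc] /predU1P[->|vc].
    - by rewrite -expr2 sqr_ge0.
    - exact: H.
    - by rewrite mulrC; apply: H.
    - exact: cc.
  have hpq : Num.sg (pairing h p) = Num.sg (pairing h q).
    move: bp hp hq; rewrite -bq; case: (ltrgt0P (pairing h p)) => // hp;
    case: (ltrgt0P (pairing h q)) => // hq _ _ _; by [rewrite !gtr0_sg|rewrite !ltr0_sg].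
  have pq : signs p = signs q.
    apply/signsP => g gS.
    have E : Num.sg (pairing g (prj h p)) = Num.sg (pairing g (prj h q)).
      by rewrite (open_cone_sg _ cp) ?(open_cone_sg _ cq) // => u v; apply: cc.
    have [gq0|gq0] := eqVneq (pairing g (prj h q)) 0; last first.
      case: (hit_q g gS) => [gq|<-]; first by rewrite gq eqxx in gq0.
      case: (hit_p g gS) => [gp|<- //].
      by move: E; rewrite gp sgr0 => /esym/eqP; rewrite sgr_eq0 (negPf gq0).
    have hv : pairing h (v0 q) != 0 by rewrite -sgr_eq0 sv // sgr_eq0.
    (* [g] and [h] vanish together at the exit point, so by genericity they are proportional on [W],
       and the side of [h] decides the sign of [g]. *)
    have gen : pairing g q * pairing h (v0 q) = pairing h q * pairing g (v0 q).
      move: gq0; rewrite pairingB pairingZ => /eqP; rewrite subr_eq0 => /eqP ->.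
      by rewrite mulrAC divfK.
    have := congr1 Num.sg (v_gen g h gS hS gen p pW); rewrite !sgrM hpq mulrC.
    by move/mulfI => -> //; rewrite sgr_eq0.
  have hv : pairing h (v0 p) != 0 by rewrite -sgr_eq0 (sgv _ pQ) // sgr_eq0.
  have vpq : v0 p = v0 q by apply: v_eq.
  exists (v0 q :: c); rewrite ?inE //=; exists (pairing h p / pairing h (v0 p)).
    rewrite -sgr_cp0 sgrM sgrV (sgv _ pQ) //.
    by case: (ltrgt0P (pairing h p)) hp => // hp _; rewrite ?(gtr0_sg hp) ?(ltr0_sg hp) ?mulrNN mulr1.
  by rewrite -vpq.
have [ofx Hof] := choice exo.
pose S' := [seq g <- S | ~~ (W <= lker g)%VS].
pose ext h := Lf h ++ flatten [seq ofx (h, cb) | cb <- [seq (c, b) | c <- Lf h, b <- [:: true; false]]].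
have S'P h : h \in S' <-> h \in S /\ exists2 x, x \in W & pairing h x != 0.
  rewrite mem_filter; split=> [/andP[/subvPn [x xW]]|[-> [x xW hx]]].
    by rewrite memv_ker => hx ->; split=> //; exists x.
  by rewrite andbT; apply/subvPn; exists x; rewrite // memv_ker.
exists (flatten [seq ext h | h <- S']); split.
- have -> : (3 * (3 * size S) ^ k.+1 = size S * (3 * (3 * (3 * size S) ^ k)))%N by rewrite expnS; ring.
  apply: (@leq_trans (size S' * (3 * (3 * (3 * size S) ^ k)))); last first.
    by rewrite leq_mul2r size_filter count_size orbT.
  apply: size_flatten_map_leq => h /S'P [hS /HLf [h1 h2 h3]].
  rewrite size_cat.
  have : (size (flatten [seq ofx (h, cb) | cb <- [seq (c, b) | c <- Lf h, b <- [:: true; false]]])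
      <= size [seq (c, b) | c <- Lf h, b <- [:: true; false]] * 1)%N.
    apply: size_flatten_map_leq => -[c b] /allpairsP [[c' b'] /= [cL _ [-> ->]]].
    by have [] := Hof (h, (c', b')) hS (h2 _ cL).
  rewrite size_allpairs /=; lia.
- move=> c /flattenP [_ /mapP [h /S'P [hS /HLf [h1 h2 h3]] ->]].
  rewrite mem_cat => /orP[/h2 [c1 c2]|]; first by split=> //; apply: leqW.
  case/flattenP => _ /mapP [_ /allpairsP [[c' b'] /= [cL _ ->]] ->].
  by have [_ H _] := Hof (h, (c', b')) hS (h2 _ cL); apply: H.
- move=> q qQ qW.
  (* A point on a wall is covered by the recursion inside that wall. *)
  case: (pselect (off_walls W q)) => oq; last first.
    have [h hS' hq] : exists2 h, h \in S' & pairing h q = 0.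
      apply: contrapT => H; apply: oq => g gS gq x xW.
      apply/eqP; apply: contrapT => /negP gx; apply: H; exists g => //.
      by apply/S'P; split=> //; exists x.
    have [hS hW] := (S'P h).1 hS'; have [_ _ H] := HLf h hW.
    have [||c cL cq] := H q; first by rewrite mem_cat qQ.
      by rewrite memv_cap qW memv_ker; apply/eqP.
    exists c => //; apply/flattenP; exists (ext h); first exact: map_f.
    by rewrite mem_cat cL.
  have [h hS hit_q] := ex_hit q qQ qW oq; have [hq _] := hit_q.
  have hW : exists2 x, x \in W & pairing h x != 0 by exists q.
  have hS' : h \in S' by apply/S'P.
  have hv : pairing h (v0 q) != 0 by rewrite -sgr_eq0 (sgv _ qQ) // sgr_eq0.
  have [_ L2 H] := HLf h hW.
  have [||c cL cq] := H (prj h q); first by rewrite mem_cat map_f ?orbT.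
    rewrite memv_cap; apply/andP; split.
      by rewrite memvB // memvZ //; have [] := Hv0 _ qQ qW oq.
    by rewrite memv_ker; apply/eqP; rewrite -/(pairing _ _) pairingB pairingZ divfK // subrr.
  have [_ _ Ho] := Hof (h, (c, 0 < pairing h q)) hS (L2 _ cL).
  have [|c' c'o c'q] := Ho q; first by split.
  exists c' => //; apply/flattenP; exists (ext h); first exact: map_f.
  rewrite mem_cat; apply/orP; right; apply/flattenP.
  exists (ofx (h, (c, 0 < pairing h q))) => //; apply: map_f.
  by apply/allpairsP; exists (c, 0 < pairing h q); rewrite /= !inE; case: (0 < _).
Qed.

End Triangulation.

(** * Cuttings *)

(** By averaging, some element lies in a fraction at least [w / #|I|] of the sets not yet hit, and
    it is chosen next. The resulting geometric decay is stated without division. *)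
Lemma greedy_hitting (I : finType) (F : {set {set I}}) (w j : nat) :
  (0 < w)%N -> (forall A : {set I}, A \in F -> (w <= #|A|)%N) ->
  exists2 T : {set I}, (#|T| <= j)%N &
    (#|I| ^ j * #|[set A in F | [disjoint A & T]]| <= (#|I| - w) ^ j * #|F|)%N.
Proof.
move=> w0 Fw; elim: j => [|j [T Tj HT]].
  exists finset.set0; rewrite ?cards0 // !expn0 !mul1n subset_leq_card //.
  by apply/fintype.subsetP => A; rewrite inE => /andP[].
set U := [set A in F | _] in HT.
have FU A : A \in U -> A \in F by rewrite inE => /andP[].
have [I0|I0] := posnP #|I|.
  exists T; first exact: leqW.
  by rewrite I0 exp0n // mul0n.
have dc : (\sum_i #|[set A in U | i \in A]| = \sum_(A in U) #|A|)%N.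
  under eq_bigr => i _ do rewrite -sum1dep_card.
  rewrite (exchange_big_dep (mem U)) /=; last by move=> i A _ /andP[].
  apply: eq_bigr => A AU; rewrite -sum1_card.
  by apply: eq_bigl => i; rewrite AU.
have Uw : (w * #|U| <= \sum_(A in U) #|A|)%N.
  by rewrite mulnC -sum_nat_const; apply: leq_sum => A /FU /Fw.
have [i Hi] : exists i, (w * #|U| <= #|I| * #|[set A in U | i \in A]|)%N.
  apply: contrapT => H.
  have lt i : (#|I| * #|[set A in U | i \in A]| < w * #|U|)%N.
    by rewrite ltnNge; apply/negP => h; apply: H; exists i.
  have : (\sum_(i : I) (#|I| * #|[set A in U | i \in A]|).+1 <= \sum_(i : I) w * #|U|)%N.
    by apply: leq_sum => i _; apply: lt.
  under eq_bigr => i _ do rewrite -addn1.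
  rewrite big_split /= -big_distrr /= dc !sum_nat_const muln1.
  have : (#|I| * (w * #|U|) <= #|I| * \sum_(A in U) #|A|)%N by rewrite leq_mul2l Uw orbT.
  move=> h1 h2; have := leq_trans (leq_add h1 (leqnn #|I|)) h2.
  by rewrite -[X in (_ <= X)%N]addn0 leq_add2l leqNgt I0.
exists (i |: T); first by rewrite (leq_trans (leq_card_setU _ _)) // cards1.
set U' := [set A in F | _].
have cU : (#|U'| + #|[set A in U | i \in A]| <= #|U|)%N.
  rewrite -(finset.cardsID [set A : {set I} | i \in A] U) addnC leq_add // subset_leq_card //.
    by apply/fintype.subsetP => A; rewrite !inE.
  apply/fintype.subsetP => A; rewrite !inE => /andP[-> AT] /=.
  rewrite (disjointFl AT) ?inE ?eqxx //=.
  by apply: disjointWr AT; apply/fintype.subsetP => y yT; rewrite inE yT orbT.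
have step : (#|I| * #|U'| <= (#|I| - w) * #|U|)%N by rewrite mulnBl; nia.
rewrite !expnS; apply: (@leq_trans (#|I| ^ j * ((#|I| - w) * #|U|))).
  by rewrite (mulnC #|I|) -mulnA leq_mul2l step orbT.
by rewrite mulnCA -mulnA leq_mul2l HT orbT.
Qed.

Section Cutting.
Variables (R : realFieldType) (V : vectType R) (k : nat).
Hypothesis dimV : \dim {:V} = k.+1.

(** Coordinate functionals, appended to a sample of forms to make it satisfy [S_span]. *)
Lemma spanning_functionals : exists2 B : seq 'Hom(V, R^o), size B = k.+1 &
  forall x, (forall g, g \in B -> pairing g x = 0) -> x = 0.
Proof.
exists [seq linfun (coord (vbasis {:V}) i : V -> R^o) | i <- enum 'I_(\dim {:V})].
  by rewrite size_map size_enum_ord dimV.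
move=> x H; rewrite (coord_vbasis (memvf x)) big1 // => i _.
have := H _ (map_f _ (mem_enum _ i)).
by rewrite /pairing lfunE /= => ->; rewrite scale0r.
Qed.

Variables (I : finType) (f : I -> 'Hom(V, R^o)).

Definition sign_pattern (x : V) : {ffun I -> bool * bool} :=
  [ffun i => (0 < pairing (f i) x, pairing (f i) x < 0)].

Lemma sign_patternP x y :
  (forall i, Num.sg (pairing (f i) x) = Num.sg (pairing (f i) y)) ->
  sign_pattern x = sign_pattern y.
Proof.
by move=> H; apply/ffunP => i; rewrite !ffunE -sgr_gt0 -[_ < 0]sgr_lt0 H sgr_gt0 sgr_lt0.
Qed.

(** Triangulate the arrangement of all [f i] so as to cover one representative of each realized
    pattern; a simplex carries a single pattern, so counting simplices suffices. *)
Lemma card_sign_patterns : exists2 P : {set {ffun I -> bool * bool}},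
  (forall x, sign_pattern x \in P) & (#|P| <= 3 * (3 * (#|I| + k.+1)) ^ k)%N.
Proof.
have [B sB B_span] := spanning_functionals.
pose S := [seq f i | i <- enum I] ++ B.
have fS i : f i \in S by rewrite mem_cat map_f ?mem_enum.
have S_span x : (forall g, g \in S -> pairing g x = 0) -> x = 0.
  by move=> H; apply: B_span => g gB; apply: H; rewrite mem_cat gB orbT.
have sS : size S = (#|I| + k.+1)%N by rewrite size_cat size_map -cardE sB.
have exX (p : {ffun I -> bool * bool}) : exists x, (exists y, sign_pattern y = p) -> sign_pattern x = p.
  by case: (pselect (exists y, sign_pattern y = p)) => [[y <-]|H]; [exists y|exists 0].
have [X HX] := choice exX.
have [||L [L1 L2 L3]] := chains S_span (k := k) (W := fullv) (map X (enum {ffun I -> bool * bool})).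
- by rewrite sS addnS.
- by rewrite dimV.
have exh (c : seq V) : exists p, forall x, c \in L -> open_cone c x -> sign_pattern x = p.
  case: (pselect (exists2 x, c \in L & open_cone c x)); last first.
    by move=> H; exists [ffun=> (true, true)] => x cL cx; case: H; exists x.
  case=> x cL cx; exists (sign_pattern x) => y _ cy; apply: sign_patternP => i.
  have cc u v : u \in c -> v \in c -> 0 <= pairing (f i) u * pairing (f i) v.
    by have [_ H] := L2 c cL; apply: H.
  by rewrite (open_cone_sg cc cx) (open_cone_sg cc cy).
have [h Hh] := choice exh.
exists [set p | `[< exists y, sign_pattern y = p >]].
  by move=> x; rewrite inE; apply/asboolP; exists x.
rewrite -sS; apply: leq_trans L1; rewrite -(size_map h) cardE.
apply: uniq_leq_size; first exact: enum_uniq.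
move=> p; rewrite mem_enum inE => /asboolP /HX Xp.
have [||c cL cX] := L3 (X p); rewrite ?memvf ?map_f ?mem_enum //.
by rewrite -Xp (Hh c (X p)) // map_f.
Qed.

Definition separators (p q : {ffun I -> bool * bool}) :=
  [set i | (p i).1 && (q i).2 || (p i).2 && (q i).1].

Lemma mem_separators x y i : (i \in separators (sign_pattern x) (sign_pattern y)) =
  (pairing (f i) x * pairing (f i) y < 0).
Proof.
rewrite inE !ffunE /=.
case: (ltrgt0P (pairing (f i) x)) => [x0|x0|->] /=.
- by rewrite orbF pmulr_rlt0.
- by rewrite nmulr_rlt0.
- by rewrite mul0r ltxx.
Qed.

Definition crossing (J : finType) (x : J -> V) (A : {set J}) : {set I} :=
  [set i | [exists a in A, exists b in A,
     Num.sg (pairing (f i) (x a)) != Num.sg (pairing (f i) (x b))]].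

(** The inequality on [s] says that a greedy sample of at most [s] forms leaves less than one large
    separating family unhit. Two vertices of a simplex are then separated by at most [w] forms; a
    crossing form separates some pair of vertices, so a union bound over pairs finishes. *)
Lemma cutting (J : finType) (x : J -> V) (w s : nat) : (0 < w)%N ->
  ((#|I| - w) ^ s * (3 * (3 * (#|I| + k.+1)) ^ k) ^ 2 < #|I| ^ s)%N ->
  exists K (key : J -> 'I_K), (K <= 3 * (3 * (s + k.+1)) ^ k)%N /\
    forall a, (#|crossing x [set j | key j == a]| <= k.+1 ^ 2 * w)%N.
Proof.
move=> w0 Hs; have [P Px cP] := card_sign_patterns.
pose F := [set A in [set separators t.1 t.2 | t in finset.setX P P] | (w <= #|A|)%N].
have Fw (A : {set I}) : A \in F -> (w <= #|A|)%N by rewrite inE => /andP[].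
have cF : (#|F| <= (3 * (3 * (#|I| + k.+1)) ^ k) ^ 2)%N.
  apply: (@leq_trans (#|P| ^ 2)); last by rewrite leq_exp2r.
  rewrite -mulnn -cardsX; apply: leq_trans (leq_imset_card (fun t => separators t.1 t.2) _).
  by apply: subset_leq_card; apply/fintype.subsetP => A; rewrite inE => /andP[].
have [T Ts HT] := greedy_hitting s w0 Fw.
have hitF A : A \in F -> exists2 i, i \in A & i \in T.
  move=> AF; have : ~~ [disjoint A & T].
    apply/negP => dA; have : (0 < #|[set A in F | [disjoint A & T]]|)%N.
      by apply/card_gt0P; exists A; rewrite inE AF.
    move=> U0; have : (#|I| ^ s <= (#|I| - w) ^ s * #|F|)%N by apply: leq_trans HT; rewrite leq_pmulr.
    rewrite leqNgt; case/negP; apply: leq_ltn_trans Hs; by rewrite leq_mul2l cF orbT.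
  by move=> /pred0Pn [i /andP[iA iT]]; exists i.
have [B sB B_span] := spanning_functionals.
pose S := [seq f i | i <- enum T] ++ B.
have S_span y : (forall g, g \in S -> pairing g y = 0) -> y = 0.
  by move=> H; apply: B_span => g gB; apply: H; rewrite mem_cat gB orbT.
have sS : size S = (#|T| + k.+1)%N by rewrite size_cat size_map -cardE sB.
have [||L [L1 L2 L3]] := chains S_span (k := k) (W := fullv) (map x (enum J)).
- by rewrite sS addnS.
- by rewrite dimV.
have exk j : exists a : 'I_(size L), open_cone (nth [::] L a) (x j).
  have [||c /(nthP [::]) [a aL <-] cx] := L3 (x j); rewrite ?memvf ?map_f ?mem_enum //.
  by exists (Ordinal aL).
have [key Hkey] := choice exk.
exists (size L), key; split.
  have mono a b e : (a <= b -> a ^ e <= b ^ e)%N by case: e => // e ab; rewrite leq_exp2r.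
  by apply: (leq_trans L1); rewrite leq_pmul2l // mono // sS leq_pmul2l // leq_add2r.
move=> a; set c := nth [::] L a.
have [sc cc] : (size c <= k.+1)%N /\ compatible S c by apply: L2; apply: mem_nth.
pose Sep (uv : 'I_(size c) * 'I_(size c)) :=
  separators (sign_pattern c`_uv.1) (sign_pattern c`_uv.2).
have Sepw uv : (#|Sep uv| <= w)%N.
  rewrite leqNgt; apply/negP => /ltnW wS.
  have : Sep uv \in F.
    rewrite inE wS andbT; apply/imsetP.
    by exists (sign_pattern c`_uv.1, sign_pattern c`_uv.2); rewrite // inE /= !Px.
  case/hitF => i; rewrite mem_separators => iS iT.
  have : f i \in S by rewrite mem_cat map_f ?mem_enum.
  move=> fiS; have := cc _ _ _ fiS (mem_nth 0 (ltn_ord uv.1)) (mem_nth 0 (ltn_ord uv.2)).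
  by rewrite leNgt iS.
apply: (@leq_trans #|\bigcup_uv Sep uv|).
  apply: subset_leq_card; apply/fintype.subsetP => i; rewrite inE.
  case/existsP => j1 /andP[]; rewrite inE => /eqP j1a /existsP [j2 /andP[]].
  rewrite inE => /eqP j2a neq.
  have c1 : open_cone c (x j1) by rewrite /c -j1a.
  have c2 : open_cone c (x j2) by rewrite /c -j2a.
  have [u [v [/(nthP 0) [u' uc <-] /(nthP 0) [v' vc <-] uv]]] := open_cone_split c1 c2 neq.
  by apply/bigcupP; exists (Ordinal uc, Ordinal vc) => //; rewrite mem_separators.
apply: (@leq_trans (\sum_uv #|Sep uv|)).
  elim/big_rec2: _ => [|uv m A _ IH]; first by rewrite cards0.
  by rewrite (leq_trans (leq_card_setU _ _)) // leq_add2l.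
apply: (@leq_trans (\sum_(uv : 'I_(size c) * 'I_(size c)) w)); first exact: leq_sum.
rewrite sum_nat_const card_prod card_ord leq_mul2r -mulnn leq_mul ?orbT //.
Qed.

End Cutting.

(** * Points of large degree *)

Lemma sum_nat_cauchy_schwarz (I : finType) (B : {set I}) (c : I -> nat) :
  ((\sum_(i in B) c i) ^ 2 <= #|B| * \sum_(i in B) c i ^ 2)%N.
Proof.
have H : (\sum_(i in B) \sum_(j in B) 2 * (c i * c j) <=
      \sum_(i in B) \sum_(j in B) (c i ^ 2 + c j ^ 2))%N.
  by apply: leq_sum => i _; apply: leq_sum => j _; apply: nat_Cauchy.
have E1 : (\sum_(i in B) \sum_(j in B) 2 * (c i * c j) = 2 * (\sum_(i in B) c i) ^ 2)%N.
  rewrite -mulnn big_distrl big_distrr /=; apply: eq_bigr => i _.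
  by rewrite !big_distrr.
have E2 : (\sum_(i in B) \sum_(j in B) (c i ^ 2 + c j ^ 2) =
    2 * (#|B| * \sum_(i in B) c i ^ 2))%N.
  under eq_bigr => i _ do rewrite big_split sum_nat_const /=.
  by rewrite big_split sum_nat_const /= -big_distrr /= mul2n addnn.
by move: H; rewrite E1 E2 leq_pmul2l.
Qed.

Lemma card_setIdE (T : finType) (A : {set T}) (p : pred T) :
  (#|[set a in A | p a]| = \sum_(a in A) p a)%N.
Proof.
rewrite -sum1dep_card big_mkcond [RHS]big_mkcond /=.
by apply: eq_bigr => a _; case: (a \in A); case: (p a).
Qed.

Lemma sum_incidences (I J : finType) (e : I -> J -> bool) (A : {set J}) (B : {set I}) :
  (\sum_(a in A) #|[set i in B | e i a]| = \sum_(i in B) #|[set a in A | e i a]|)%N.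
Proof.
under eq_bigr => a _ do rewrite card_setIdE.
under [RHS]eq_bigr => a _ do rewrite card_setIdE.
by rewrite exchange_big.
Qed.

(** Cauchy-Schwarz over the forms leaves a count of pairs of points on a common form: the diagonal
    returns the incidences, and every other pair contributes at most [t]. *)
Lemma kovari_sos_turan (I J : finType) (e : I -> J -> bool) (t : nat)
    (A : {set J}) (B : {set I}) :
  (forall a b, a != b -> #|[set i | e i a && e i b]| <= t)%N ->
  ((\sum_(a in A) #|[set i in B | e i a]|) ^ 2 <=
    #|B| * (\sum_(a in A) #|[set i in B | e i a]| + t * #|A| ^ 2))%N.
Proof.
move=> et; rewrite {1}sum_incidences.
apply: leq_trans (sum_nat_cauchy_schwarz _ _) _; rewrite leq_mul2l; apply/orP; right.
have -> : (\sum_(i in B) #|[set a in A | e i a]| ^ 2 =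
    \sum_(a in A) \sum_(b in A) #|[set i in B | e i a && e i b]|)%N.
  transitivity (\sum_(i in B) \sum_(a in A) \sum_(b in A) (e i a && e i b))%N.
    apply: eq_bigr => i _.
    rewrite -mulnn card_setIdE big_distrl /=; apply: eq_bigr => a _.
    by rewrite big_distrr /=; apply: eq_bigr => b _; rewrite mulnb.
  rewrite exchange_big /=; apply: eq_bigr => a _.
  by rewrite exchange_big /=; apply: eq_bigr => b _; rewrite card_setIdE.
have -> : (t * #|A| ^ 2 = \sum_(a in A) \sum_(b in A) t)%N.
  by rewrite !sum_nat_const -mulnn; ring.
rewrite -big_split /=; apply: leq_sum => a aA.
rewrite (bigD1 a) //= leq_add //.
  by apply/subset_leq_card/fintype.subsetP => i; rewrite !inE andbb.
rewrite [X in (_ <= X)%N](bigD1 a) //=; apply: (@leq_trans (\sum_(b in A | b != a) t)%N).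
  apply: leq_sum => b /andP[_ ba]; apply: leq_trans (et a b _); last by rewrite eq_sym.
  by apply/subset_leq_card/fintype.subsetP => i; rewrite !inE => /andP[].
by rewrite leq_addl.
Qed.

(* The constant 128 makes the main Kovari-Sos-Turan term at most [k * m / 8]. *)
Lemma kst_dichotomy (E B m t k : nat) : (E ^ 2 <= B * (E + t * m ^ 2))%N ->
  (128 * B * t <= k ^ 2)%N -> (8 * E <= 16 * B + k * m)%N.
Proof.
move=> EB Bk; have [E2|E2] := leqP E (2 * B)%N; first by lia.
have h1 : (E ^ 2 <= 2 * B * t * m ^ 2)%N by nia.
have h2 : (128 * B * t * m ^ 2 <= k ^ 2 * m ^ 2)%N by rewrite leq_mul2r Bk orbT.
suff : (8 * E <= k * m)%N by lia.
rewrite -(@leq_exp2r _ _ 2) // !expnMn; lia.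
Qed.

Section Rich.
Variables (R : realFieldType) (V : vectType R) (I J : finType) (f : I -> 'Hom(V, R^o)) (x : J -> V).

Definition incident i j := pairing (f i) (x j) == 0.
Definition degree j := #|[set i | incident i j]|.

Variable t : nat.
Hypothesis pair_t : forall a b, a != b -> (#|[set i | incident i a && incident i b]| <= t)%N.

Lemma very_rich_points (A : {set J}) (s : nat) :
  (forall a, a \in A -> (4 * (#|I| * t) <= degree a ^ 2)%N) ->
  (forall a, (degree a <= s)%N) ->
  (\sum_(a in A) degree a ^ 2 <= 2 * (s * #|I|))%N.
Proof.
move=> Ak ds; set E := (\sum_(a in A) degree a)%N.
have H : (\sum_(a in A) degree a ^ 2 <= s * E)%N.
  by rewrite big_distrr /=; apply: leq_sum => a _; rewrite -mulnn leq_mul2r ds orbT.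
suff : (E <= 2 * #|I|)%N by nia.
have := kovari_sos_turan A [set: I] pair_t.
have -> : (\sum_(a in A) #|[set i in [set: I] | incident i a]|)%N = E.
  by apply: eq_bigr => a _; congr (#|pred_of_set _|); apply/setP => i; rewrite !inE.
rewrite cardsT => HE.
(* Any two degrees in [A] have product at least [4 * (#|I| * t)], so the quadratic term of [HE] is
   at most a quarter of [E ^ 2]. *)
have : (4 * (#|I| * t) * #|A| ^ 2 <= E ^ 2)%N.
  rewrite -[(E ^ 2)%N]mulnn big_distrl /= mulnC -mulnn -mulnA -[leqLHS]sum_nat_const.
  apply: leq_sum => a aA; rewrite -sum_nat_const big_distrr /=.
  apply: leq_sum => b bA; rewrite -(@leq_exp2r _ _ 2) // -[leqLHS]mulnn expnMn.
  by rewrite leq_mul ?Ak.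
nia.
Qed.

Variable d : nat.
Hypothesis dimV : \dim {:V} = d.+1.

Lemma rich_points (A : {set J}) (k w s : nat) : (0 < w)%N ->
  ((#|I| - w) ^ s * (3 * (3 * (#|I| + d.+1)) ^ d) ^ 2 < #|I| ^ s)%N ->
  (forall a, a \in A -> (k <= degree a)%N) -> (2 * t <= k)%N ->
  (128 * (d.+1 ^ 2 * w) * t <= k ^ 2)%N ->
  (k * #|A| <= (k + 6 * (d.+1 ^ 2 * w)) * (3 * (3 * (s + d.+1)) ^ d))%N.
Proof.
move=> w0 Hs Ak tk; set B := (d.+1 ^ 2 * w)%N => Bk.
have [K [key [KK Hkey]]] := cutting dimV f x w0 Hs.
suff : (k * #|A| <= (k + 6 * B) * K)%N.
  by move=> H; apply: leq_trans H _; rewrite leq_mul2l KK orbT.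
pose X a := crossing f x [set j | key j == a].
(* Isolated points number at most one per simplex; only the others need an incidence bound. *)
pose alone a := [forall b in A, (key b == key a) ==> (b == a)].
pose A' := [set a in A | ~~ alone a]; pose A0 := [set a in A | alone a].
have cA : (#|A| <= #|A0| + #|A'|)%N.
  rewrite -(cardsID [set a | alone a] A) leq_add // subset_leq_card //;
  by apply/fintype.subsetP => a; rewrite !inE // andbC.
have cA0 : (#|A0| <= K)%N.
  rewrite -[K]card_ord; apply: (leq_card_in key) => a b.
  rewrite !inE => /andP[aA _] /andP[bA /forallP /(_ a)].
  by rewrite aA /= => /implyP H E; apply/eqP/H; rewrite E.
pose g a := #|[set i in X (key a) | incident i a]|.
(* A form containing the whole class of [a] also contains a second point, so at most [t]
   of the forms incident to [a] fail to cross its class. *)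
have gk a : a \in A' -> (k <= 2 * g a)%N.
  rewrite inE => /andP[aA /forallPn [b]].
  rewrite !negb_imply => /and3P[bA /eqP kab ba].
  have := Ak a aA; have := @pair_t b a ba.
  suff : (degree a <= #|[set i | incident i b && incident i a]| + g a)%N by lia.
  rewrite /degree -(cardsID (X (key a)) [set i | incident i a]) addnC leq_add //;
    apply/subset_leq_card/fintype.subsetP => i; rewrite !inE; last first.
    by rewrite andbC.
  move=> /andP[nX ia]; rewrite ia andbT.
  apply/negPn/negP => ib; case/negP: nX; apply/existsP; exists b.
  rewrite inE kab eqxx /=; apply/existsP; exists a; rewrite inE eqxx /=.
  by move: ia ib; rewrite /incident => /eqP ->; rewrite sgr0 sgr_eq0.
have S1 : (k * #|A'| <= 2 * \sum_(a in A') g a)%N.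
  by rewrite mulnC -sum_nat_const big_distrr /=; apply: leq_sum => a /gk.
have S2 : (8 * \sum_(a in A') g a <= 16 * B * K + k * #|A'|)%N.
  pose A'_ c := [set a in A' | key a == c].
  have split_sum (F : J -> nat) : (\sum_(a in A') F a = \sum_c \sum_(a in A'_ c) F a)%N.
    rewrite (partition_big key xpredT) //=; apply: eq_bigr => c _.
    by apply: eq_bigl => a; rewrite !inE.
  rewrite split_sum -[in X in (_ <= X)%N]sum1_card split_sum.
  have -> : (16 * B * K = \sum_(c < K) 16 * B)%N by rewrite sum_nat_const card_ord mulnC.
  rewrite !big_distrr -big_split /=; apply: leq_sum => c _.
  rewrite sum1_card; apply: (@kst_dichotomy _ _ #|A'_ c| t) => //.
  have -> : (\sum_(a in A'_ c) g a = \sum_(a in A'_ c) #|[set i in X c | incident i a]|)%N.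
    by apply: eq_bigr => a; rewrite inE /g => /andP[_ /eqP ->].
  apply: leq_trans (kovari_sos_turan _ _ pair_t) _.
  by rewrite leq_mul2r Hkey orbT.
(* [S1] and [S2] bound the sum of the [g a] by [8 * B * K / 3], hence [k * #|A'|] by [6 * B * K];
   the isolated points account for [k * K]. *)
nia.
Qed.

End Rich.

(** * Estimates *)

Section Estimates.
Variable R : realType.

(** [1 - w / n] is at most the exponential of [- w / n], and [s] is large enough for [s * w / n] to
    exceed [ln M]. *)
Lemma decay_steps (n w M s : nat) (E : R) : (0 < n)%N -> (0 < M)%N -> (0 < w)%N ->
  ln M%:R <= E -> n%:R * E / w%:R < s%:R -> ((n - w) ^ s * M < n ^ s)%N.
Proof.
move=> n0 M0 w0 ME Es.
have n0' : 0 < n%:R :> R by rewrite ltr0n.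
have w0' : 0 < w%:R :> R by rewrite ltr0n.
have M0' : 0 < M%:R :> R by rewrite ltr0n.
have base : (n - w)%:R <= n%:R * expR (- (w%:R / n%:R)) :> R.
  have [nw|wn] := leqP n w.
    by rewrite (eqP nw) mulr_ge0 ?ler0n ?expR_ge0.
  rewrite natrB ?(ltnW wn) //.
  have -> : n%:R - w%:R = n%:R * (1 + - (w%:R / n%:R)) :> R by field; rewrite gt_eqF.
  by rewrite ler_pM2l // expR_ge1Dx.
rewrite -(ltr_nat R) natrM !natrX.
apply: (@le_lt_trans _ _ ((n%:R * expR (- (w%:R / n%:R))) ^+ s * M%:R)).
  by rewrite ler_pM2r // lerXn2r ?nnegrE ?mulr_ge0 ?ler0n ?expR_ge0.
rewrite exprMn -expRM_natr -mulrA gtr_pMr ?exprn_gt0 //.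
rewrite -[X in _ * X < _](@lnK _ M%:R) ?posrE // -expRD expR_lt1.
have H : E < w%:R / n%:R * s%:R.
  by rewrite mulrAC ltr_pdivlMr // mulrC (mulrC w%:R) -ltr_pdivrMr.
by rewrite mulNr; lra.
Qed.

Lemma ln_nat_le_powR (delta : R) (n : nat) : 0 < delta -> (0 < n)%N ->
  ln n%:R <= delta^-1 * n%:R `^ delta.
Proof.
move=> d0 n0; rewrite ler_pdivlMl // -ln_powR.
apply/ltW/ln_sublinear; rewrite powR_gt0 //. by rewrite ltr0n.
Qed.

Lemma one_le_powR_nat (delta : R) (n : nat) : 0 <= delta -> (0 < n)%N -> 1 <= n%:R `^ delta.
Proof.
move=> d0 n0; rewrite -[leLHS](@powRr0 _ n%:R) ler_powR // ler1n //.
Qed.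

(** One constant serves both logarithmic losses: the sample size of the cutting and the number of
    dyadic ranges. *)
Lemma logarithms_le_powR (d : nat) (delta : R) : (0 < d)%N -> 0 < delta ->
  exists2 c : R, 1 <= c & forall n : nat, (0 < n)%N ->
    ln ((3 * (3 * (n + d.+1)) ^ d) ^ 2)%N%:R <= c * n%:R `^ delta /\
    (trunc_log 2 n).+1%:R <= c * n%:R `^ delta.
Proof.
move=> d0 de0.
pose a : R := ln (9 * d.+2)%:R.
have a0 : 0 <= a by rewrite ln_ge0 // ler1n.
have l2 : 0 < ln 2 :> R by rewrite ln_gt0 // ltr1n.
pose c1 : R := (d * 2)%:R * (a + delta^-1).
pose c2 : R := delta^-1 / ln 2.
have i0 : 0 < delta^-1 by rewrite invr_gt0.
have c10 : 0 <= c1 by rewrite mulr_ge0 // addr_ge0 // ltW.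
have c20 : 0 <= c2 by rewrite divr_ge0 // ltW.
exists (1 + c1 + c2); first by lra.
move=> n n0; have p1 := one_le_powR_nat (ltW de0) n0.
have ln_n := ln_nat_le_powR de0 n0.
have c1p : 0 <= c1 * n%:R `^ delta by rewrite mulr_ge0 // powR_ge0.
have c2p : 0 <= c2 * n%:R `^ delta by rewrite mulr_ge0 // powR_ge0.
have n0' : 0 < n%:R :> R by rewrite ltr0n.
split; rewrite !mulrDl mul1r.
  suff : ln ((3 * (3 * (n + d.+1)) ^ d) ^ 2)%N%:R <= c1 * n%:R `^ delta by lra.
  have MB : ((3 * (3 * (n + d.+1)) ^ d) ^ 2 <= (9 * d.+2 * n) ^ (d * 2))%N.
    rewrite expnM leq_exp2r //.
    have -> : (9 * d.+2 * n = 3 * (3 * (d.+2 * n)))%N by lia.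
    rewrite [leqRHS]expnMn leq_mul //; first by case: (d) d0 => // d' _; rewrite expnS leq_pmulr ?expn_gt0.
    by rewrite leq_exp2r // leq_pmul2l //; nia.
  have M0 : (0 < (3 * (3 * (n + d.+1)) ^ d) ^ 2)%N by rewrite !(expn_gt0, muln_gt0) addnS.
  apply: (@le_trans _ _ (ln ((9 * d.+2 * n) ^ (d * 2))%N%:R)).
    rewrite ler_ln ?posrE ?ltr0n ?ler_nat //.
    by rewrite expn_gt0 !muln_gt0 n0.
  rewrite natrX lnXn ?ltr0n ?muln_gt0 ?n0 // natrM lnM ?posrE ?ltr0n // -/a.
  rewrite -[leLHS]mulr_natl /c1 -[leRHS]mulrA ler_wpM2l ?ler0n // mulrDl lerD //.
  by rewrite ler_peMr.
suff : (trunc_log 2 n)%:R <= c2 * n%:R `^ delta by rewrite -natr1; lra.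
rewrite /c2 mulrAC ler_pdivlMr // (le_trans _ ln_n) //.
have /andP[tn _] := trunc_log_bounds (isT : (1 < 2)%N) n0.
rewrite mulr_natl -lnXn ?ltr0n // -natrX ler_ln ?posrE ?ltr0n ?expn_gt0 // ler_nat //.
Qed.

End Estimates.

Lemma rich_count_arith (k t m B K : nat) : (0 < k)%N -> (128 * B * t <= k ^ 2)%N ->
  (k * m <= 7 * B * K)%N -> (t * m <= k * K)%N.
Proof.
move=> k0 h1 h2.
have h3 : (128 * B * t * (7 * K) <= k ^ 2 * (7 * K))%N by rewrite leq_mul2r h1 orbT.
have h4 : (128 * t * (k * m) <= 128 * t * (7 * B * K))%N by rewrite leq_mul2l h2 orbT.
have h5 : (k * (128 * (t * m)) <= k * (7 * (k * K)))%N by rewrite -mulnn in h3; lia.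
by rewrite leq_pmul2l // in h5; lia.
Qed.

(** [w] is the integer part of [k ^ 2 / (128 * D ^ 2 * t)], the largest value [rich_points] allows.
    The lower bound on [k] makes it positive, so rounding costs at most a factor 2. *)
Lemma exists_threshold (k t D : nat) : (0 < t)%N -> (1 < D)%N -> (128 * D ^ 2 * t <= k)%N ->
  exists w, [/\ (0 < w)%N, (128 * (D ^ 2 * w) * t <= k ^ 2)%N,
    (k ^ 2 <= 2 * w * (128 * D ^ 2 * t))%N, (k <= D ^ 2 * w)%N & (2 * t <= k)%N].
Proof.
move=> t0 D1 kq; set q := (128 * D ^ 2 * t)%N in kq *.
have q0 : (0 < q)%N by rewrite !muln_gt0 t0 (ltnW D1).
have k0 : (0 < k)%N := leq_trans q0 kq.
have qk : (q * k <= k ^ 2)%N by rewrite -mulnn leq_mul2r kq orbT.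
have D2 : (2 <= D ^ 2)%N by rewrite -[2%N]/(2 ^ 1)%N; apply: leq_trans (leq_pexp2l _ _ : (D ^ 1 <= _)%N); lia.
have w0 : (0 < k ^ 2 %/ q)%N by rewrite divn_gt0 // (leq_trans _ qk) // leq_pmulr.
have wq2 : (k ^ 2 <= 2 * (k ^ 2 %/ q) * q)%N.
  apply/ltnW/(leq_trans (ltn_ceil (k ^ 2) q0)).
  by rewrite leq_mul2r mul2n -addnn -addn1 leq_add2l w0 orbT.
exists (k ^ 2 %/ q)%N; split=> //.
- rewrite (_ : (128 * (D ^ 2 * (k ^ 2 %/ q)) * t = (k ^ 2 %/ q) * q)%N) ?leq_trunc_div //.
  by rewrite /q; ring.
- apply: (@leq_trans (2 * (k ^ 2 %/ q))); last by rewrite leq_mul2r D2 orbT.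
  by rewrite -(leq_pmul2l q0); apply: leq_trans qk _; rewrite mulnC in wq2.
- apply: leq_trans kq; rewrite leq_mul2r; apply/orP; right.
  by rewrite (@leq_trans 128) // leq_pmulr // (leq_trans _ D2).
Qed.

(** * Points in one dyadic range of degrees, with [d = e + 2] *)

Section Blocks.
Variables (R : realType) (V : vectType R) (e : nat).
Hypothesis dimV : \dim {:V} = e.+3.
Variables (I J : finType) (f : I -> 'Hom(V, R^o)) (x : J -> V) (t n : nat).
Hypothesis pair_t : forall a b, a != b ->
  (#|[set i | incident f x i a && incident f x i b]| <= t)%N.
Hypotheses (t0 : (0 < t)%N) (n0 : (0 < n)%N) (cI : #|I| = n) (cJ : #|J| = n).
Variable E : R.
Hypotheses (E1 : 1 <= E) (lnE : ln ((3 * (3 * (n + e.+3)) ^ e.+2) ^ 2)%N%:R <= E).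

Definition sample_const : nat := (256 * e.+3 ^ 2 + 4 * e.+4)%N.
Definition rich_const : nat := (3 * (3 * sample_const) ^ e.+2)%N.

Variables (A : {set J}) (k : nat).
Hypotheses (Ak : forall a, a \in A -> (k <= degree f x a)%N)
  (k_lower : (128 * e.+3 ^ 2 * t <= k)%N) (k_upper : (k ^ 2 <= 4 * (n * t))%N).

(** The cutting has at most a constant times [(E * n * t / k ^ 2) ^ d] simplices; inserting this
    into [t * #|A| <= k * K] and clearing powers of [k] and [t] gives the exponents. *)
Lemma rich_points_real :
  #|A|%:R * k%:R ^+ (2 * e + 3) <= rich_const%:R * (E * n%:R) ^+ e.+2 * t%:R ^+ e.+1.
Proof.
have e24 : (2 * e + 4 = 2 * e.+2)%N by lia.
have e23 : (2 * e + 4 = (2 * e + 3).+1)%N by lia.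
have E0 : 0 <= E by apply: le_trans E1.
have [w [w0 Bk wq2 kB tk]] := exists_threshold t0 (isT : 1 < e.+3)%N k_lower.
have k0 : (0 < k)%N by apply: leq_trans tk; rewrite muln_gt0.
pose s := (Num.trunc (n%:R * E / w%:R)).+1.
have x0 : 0 <= n%:R * E / w%:R by rewrite divr_ge0 ?ler0n // mulr_ge0 ?ler0n.
have /andP[s_le s_gt] := trunc_itv x0.
have M0 : (0 < (3 * (3 * (n + e.+3)) ^ e.+2) ^ 2)%N by rewrite !(expn_gt0, muln_gt0) addnS.
have Hs := decay_steps n0 M0 w0 lnE s_gt.
set K := (3 * (3 * (s + e.+3)) ^ e.+2)%N.
have tm : (t * #|A| <= k * K)%N.
  have := rich_points pair_t dimV (A := A) (k := k) (s := s) w0.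
  rewrite cI => /(_ Hs Ak tk Bk); rewrite -/K => H.
  have H7 : (k * #|A| <= 7 * (e.+3 ^ 2 * w) * K)%N.
    by apply: leq_trans H _; rewrite leq_mul2r (mulSn 6) leq_add2r kB orbT.
  exact: rich_count_arith k0 Bk H7.
have k0' : 0 < k%:R :> R by rewrite ltr0n.
have w0' : 0 < w%:R :> R by rewrite ltr0n.
have t0' : 0 < t%:R :> R by rewrite ltr0n.
have n0' : 0 < n%:R :> R by rewrite ltr0n.
have k20 : 0 < k%:R ^+ 2 :> R by rewrite exprn_gt0.
pose y : R := n%:R * t%:R / k%:R ^+ 2.
have y4 : 1 <= 4 * y.
  rewrite /y mulrA ler_pdivlMr // mul1r -natrX.
  by rewrite -natrM -natrM ler_nat.
have nEw : n%:R * E / w%:R <= 256 * e.+3%:R ^+ 2 * (E * y).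
  rewrite ler_pdivrMr // /y.
  have : k%:R ^+ 2 <= 2 * w%:R * (128 * e.+3%:R ^+ 2 * t%:R) :> R.
    by move: wq2; rewrite -(ler_nat R) !(natrM, natrX).
  move=> H.
  have -> : 256 * e.+3%:R ^+ 2 * (E * (n%:R * t%:R / k%:R ^+ 2)) * w%:R =
     n%:R * E * (2 * w%:R * (128 * e.+3%:R ^+ 2 * t%:R) / k%:R ^+ 2) :> R.
    by field; rewrite gt_eqF.
  rewrite ler_peMr ?mulr_ge0 //.
  by rewrite ler_pdivlMr // mul1r.
have sD : (s + e.+3)%:R <= sample_const%:R * (E * y).
  rewrite natrD /s -natr1 /sample_const natrD !natrM.
  have y0 : 0 <= y by lra.
  have yE : y <= E * y by apply: ler_peMl.
  have Ey : 1 <= 4 * (E * y) by lra.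
  have e4 : e.+4%:R = 1 + e.+3%:R :> R by rewrite -natr1 addrC.
  have e4p : 0 <= e.+4%:R :> R by apply: ler0n.
  have : e.+4%:R * 1 <= e.+4%:R * (4 * (E * y)) by rewrite ler_wpM2l.
  rewrite mulr1 => H; rewrite [leRHS]mulrDl; move: H e4 nEw s_le.
  move: (e.+3%:R : R) (e.+4%:R : R) (E * y) (n%:R * E / w%:R) => a b z v; lra.
have KR : K%:R <= rich_const%:R * (E * y) ^+ e.+2.
  rewrite /K /rich_const !(natrM, natrX) -mulrA -exprMn ler_pM2l ?ltr0n //.
  have h : 3%:R * (s + e.+3)%:R <= 3 * sample_const%:R * (E * y).
    by rewrite -mulrA ler_pM2l ?ltr0n.
  have h0 : 0 <= 3%:R * (s + e.+3)%:R :> R by rewrite mulr_ge0 ?ler0n.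
  by apply: lerXn2r => //; rewrite nnegrE // (le_trans h0).
rewrite -(ler_pM2l t0') mulrA.
have tmR : t%:R * #|A|%:R <= k%:R * K%:R :> R by rewrite -!natrM ler_nat.
apply: (@le_trans _ _ (k%:R * (rich_const%:R * (E * y) ^+ e.+2) * k%:R ^+ (2 * e + 3))).
  rewrite ler_pM2r ?exprn_gt0 // (le_trans tmR) // ler_pM2l //.
have -> : (E * y) ^+ e.+2 = (E * n%:R) ^+ e.+2 * t%:R ^+ e.+2 / k%:R ^+ (2 * e + 4).
  rewrite e24 exprM -exprMn -expr_div_n; congr (_ ^+ _).
  by rewrite /y !mulrA.
rewrite e23.
rewrite le_eqVlt; apply/orP; left; apply/eqP.
rewrite (exprS k%:R) (exprS t%:R e.+1).
by field; rewrite ?gt_eqF ?exprn_gt0.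
Qed.

(* Raising to the power [2d - 1 = 2e + 3] turns [m <= n] and [m k^(2d-1) <= X] into a bound on [m k^2]. *)
Lemma rich_points_power :
  (#|A|%:R * k%:R ^+ 2) ^+ (2 * e + 3) <=
    rich_const%:R ^+ 2 * E ^+ (2 * e + 4) * n%:R ^+ (4 * e + 5) * t%:R ^+ (2 * e + 2).
Proof.
have An : #|A|%:R <= n%:R :> R by rewrite ler_nat -cJ max_card.
have -> : (#|A|%:R * k%:R ^+ 2) ^+ (2 * e + 3) =
   #|A|%:R ^+ (2 * e + 1) * (#|A|%:R * k%:R ^+ (2 * e + 3)) ^+ 2 :> R.
  rewrite !exprMn -!exprM [RHS]mulrA -!exprD; congr (_ ^+ _ * _ ^+ _); lia.
have H := rich_points_real.
apply: (@le_trans _ _ (n%:R ^+ (2 * e + 1) *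
   (rich_const%:R * (E * n%:R) ^+ e.+2 * t%:R ^+ e.+1) ^+ 2)).
  have L0 : 0 <= #|A|%:R * k%:R ^+ (2 * e + 3) :> R by rewrite mulr_ge0 // exprn_ge0.
  apply: ler_pM; rewrite ?exprn_ge0 //; apply: lerXn2r; rewrite ?nnegrE //.
  exact: le_trans H.
rewrite le_eqVlt; apply/orP; left; apply/eqP.
have -> : (E * n%:R) ^+ e.+2 = E ^+ e.+2 * n%:R ^+ e.+2 by rewrite exprMn.
rewrite (_ : (4 * e + 5 = 2 * e + 1 + (e.+2 + e.+2))%N); last by lia.
rewrite (_ : (2 * e + 4 = e.+2 + e.+2)%N); last by lia.
rewrite (_ : (2 * e + 2 = e.+1 + e.+1)%N); last by lia.
rewrite (exprD n%:R (2 * e + 1)) (exprD n%:R e.+2) (exprD E) (exprD t%:R).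
move: (E ^+ _) (n%:R ^+ e.+2) (n%:R ^+ (2 * e + 1)) (t%:R ^+ _) (rich_const%:R) => a b c u v.
by ring.
Qed.

End Blocks.

(** Take [N]-th roots: [M <= 2 * N] limits the loss to the exponent [2 * delta] of [n], and [1 + K]
    dominates the root of [K]. *)
Lemma root_bound (R : realType) (N M P Q n t : nat) (delta K y : R) :
  (0 < N)%N -> (M <= 2 * N)%N -> (0 < n)%N -> 0 < delta -> 0 <= K -> 0 <= y ->
  y ^+ N <= K * (n%:R `^ delta) ^+ M * n%:R ^+ P * t%:R ^+ Q ->
  y <= (1 + K) * n%:R `^ (P%:R / N%:R + 2 * delta) * t%:R `^ (Q%:R / N%:R).
Proof.
move=> N0 MN n0 d0 K0 y0 H.
have N0' : N%:R != 0 :> R by rewrite pnatr_eq0 -lt0n.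
have n0' : n%:R != 0 :> R by rewrite pnatr_eq0 -lt0n.
have nd1 : 1 <= n%:R `^ delta := one_le_powR_nat (ltW d0) n0.
set a := n%:R `^ (_ + _); set b := t%:R `^ _.
have a0 : 0 <= a by apply: powR_ge0.
have b0 : 0 <= b by apply: powR_ge0.
have aN : a ^+ N = n%:R ^+ P * (n%:R `^ delta) ^+ (2 * N).
  rewrite /a powRD ?n0' ?implybT // exprMn; congr (_ * _).
    by rewrite -[LHS]powR_mulrn ?powR_ge0 // -powRrM divfK // powR_mulrn.
  by rewrite mulrC powRrM (powR_mulrn 2) ?powR_ge0 // exprM.
have bN : b ^+ N = t%:R ^+ Q.
  by rewrite /b -[LHS]powR_mulrn ?powR_ge0 // -powRrM divfK // powR_mulrn.
rewrite -(ler_pXn2r N0) ?nnegrE //; last by rewrite !mulr_ge0 // addr_ge0.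
apply: (le_trans H); rewrite exprMn exprMn aN bN.
rewrite ler_wpM2r ?exprn_ge0 // (mulrC (n%:R ^+ P)) mulrA ler_wpM2r ?exprn_ge0 //.
rewrite ler_pM ?exprn_ge0 ?powR_ge0 ?ler_weXn2l //.
apply: (@le_trans _ _ (1 + K)); first by rewrite lerDr.
by rewrite -[leLHS]expr1 ler_weXn2l // lerDl.
Qed.

(** * Summation over the degree ranges *)

Section Sum.
Variables (R : realType) (e : nat) (eps : R).

Lemma sum_degree_sq : 0 < eps -> exists2 C : R, 0 < C &
  forall (V : vectType R) (dimV : \dim {:V} = e.+3) (I J : finType)
    (f : I -> 'Hom(V, R^o)) (x : J -> V) (t n s : nat),
  (forall a b, a != b -> (#|[set i | incident f x i a && incident f x i b]| <= t)%N) ->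
  (0 < t)%N -> #|I| = n -> #|J| = n -> (forall a, (degree f x a <= s)%N) ->
  (\sum_a degree f x a ^ 2)%N%:R <= C * (n%:R * t%:R ^+ 2
     + n%:R `^ ((4 * e + 5)%:R / (2 * e + 3)%:R + eps)
       * t%:R `^ ((2 * e + 2)%:R / (2 * e + 3)%:R + eps) + s%:R * n%:R).
Proof.
have e23 : (0 < 2 * e + 3)%N by rewrite addnS.
have e46 : (2 * e + 4 <= 2 * (2 * e + 3))%N by lia.
(* Two shares of [delta] are lost in [root_bound] and one in the number of dyadic ranges. *)
move=> eps0; pose delta := eps / 3.
have delta0 : 0 < delta by rewrite /delta; lra.
have [c c1 Hc] := logarithms_le_powR (isT : 0 < e.+2)%N delta0.
pose K : R := (rich_const e)%:R ^+ 2 * c ^+ (2 * e + 4).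
have K0 : 0 <= K by rewrite mulr_ge0 ?exprn_ge0 //; lra.
pose C1 : R := ((256 * e.+3 ^ 2) ^ 2)%N%:R; pose C2 : R := 4 * c * (1 + K).
have C10 : 0 <= C1 by apply: ler0n.
have C20 : 0 <= C2 by rewrite /C2 mulr_ge0 ?mulr_ge0 //; lra.
exists (C1 + C2 + 2); first by lra.
move=> V dimV I J f x t n s pair_t t0 cI cJ ds.
have [n0|n0] := posnP n.
  rewrite big1 ?n0 ?mul0r ?mulr0 ?add0r ?addr0; last first.
    by move=> j; case: (fintype0 j); rewrite cJ.
  apply: mulr_ge0; first by lra.
  by rewrite ?addr_ge0 ?mulr_ge0 ?powR_ge0.
have n1 : 1 <= n%:R :> R by rewrite ler1n.
have t1 : 1 <= t%:R :> R by rewrite ler1n.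
have [lnM logn] := Hc n n0; set E := c * _ in lnM logn.
have E1 : 1 <= E by rewrite /E (le_trans c1) // ler_peMr ?one_le_powR_nat ?ltW //; lra.
have KE : K * (n%:R `^ delta) ^+ (2 * e + 4) = (rich_const e)%:R ^+ 2 * E ^+ (2 * e + 4).
  by rewrite /E [(c * _) ^+ _]exprMn [RHS]mulrA.
pose dg := degree f x.
have dgn j : (dg j <= n)%N by rewrite -cI max_card.
(* The factor 256 is twice the 128 of [k_lower], since the lower end [k] of a dyadic range is only
   known to exceed half the degree. *)
pose low j := (dg j < 256 * e.+3 ^ 2 * t)%N.
pose high j := (4 * (n * t) <= dg j ^ 2)%N.
pose mid j := ~~ low j && ~~ high j.
have split_le : (\sum_a dg a ^ 2 <= \sum_(a | low a) dg a ^ 2 +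
    \sum_(a in [set a | high a]) dg a ^ 2 + \sum_(a | mid a) dg a ^ 2)%N.
  rewrite (bigID low) /= -addnA leq_add2l (bigID high) /= leq_add2r.
  rewrite big_mkcond [leqRHS]big_mkcond; apply: leq_sum => a _; rewrite inE.
  by case: (low a); case: (high a).
have lowB : (\sum_(a | low a) dg a ^ 2)%N%:R <= C1 * (n%:R * t%:R ^+ 2).
  rewrite /C1 -natrX -!natrM ler_nat.
  apply: (@leq_trans (\sum_(a : J) (256 * e.+3 ^ 2 * t) ^ 2)).
    rewrite [leqRHS](bigID low) /=; apply: leq_trans (leq_addr _ _); apply: leq_sum => a la.
    by rewrite leq_exp2r // ltnW.
  by rewrite sum_nat_const cJ [((_ * t) ^ 2)%N]expnMn mulnCA.
have highB : (\sum_(a in [set a | high a]) dg a ^ 2)%N%:R <= 2 * (s%:R * n%:R) :> R.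
  rewrite -!natrM ler_nat -cI; apply: (very_rich_points pair_t) => // a.
  by rewrite inE /high cI.
pose N : R := n%:R `^ ((4 * e + 5)%:R / (2 * e + 3)%:R + 2 * delta)
         * t%:R `^ ((2 * e + 2)%:R / (2 * e + 3)%:R).
have N0 : 0 <= N by rewrite mulr_ge0 ?powR_ge0.
have midB : (\sum_(a | mid a) dg a ^ 2)%N%:R <= C2 * n%:R `^ delta * N.
  pose L := trunc_log 2 n.
  pose key a : 'I_L.+1 := inord (trunc_log 2 (dg a)).
  have keyE a : key a = trunc_log 2 (dg a) :> nat.
    by rewrite inordK // ltnS leq_trunc_log.
  rewrite (partition_big key xpredT) //= natr_sum.
  apply: (@le_trans _ _ (\sum_(b < L.+1) 4 * ((1 + K) * N))); last first.
    rewrite sumr_const card_ord -[leLHS]mulr_natl /C2.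
    apply: (@le_trans _ _ (E * (4 * ((1 + K) * N)))).
      by rewrite ler_wpM2r // !mulr_ge0 // addr_ge0.
    by rewrite /E le_eqVlt; apply/orP; left; apply/eqP; ring.
  apply: ler_sum => b _.
  pose A := [set a | mid a && (key a == b)].
  pose k := (2 ^ b)%N.
  have inA a : a \in A -> (k <= dg a < 2 * k)%N.
    rewrite inE => /andP[/andP[la _] /eqP kb].
    have d0 : (0 < dg a)%N.
      by move: la; rewrite /low -leqNgt; apply: leq_trans; rewrite !muln_gt0 t0.
    have := trunc_log_bounds (isT : (1 < 2)%N) d0.
    by rewrite /k -expnS -keyE kb.
  have -> : (\sum_(a | mid a && (key a == b)) dg a ^ 2 = \sum_(a in A) dg a ^ 2)%N.
    by apply: eq_bigl => a; rewrite inE.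
  apply: (@le_trans _ _ (4 * (#|A|%:R * k%:R ^+ 2))).
    rewrite -natrX -!natrM ler_nat mulnCA -sum_nat_const.
    apply: leq_sum => a /inA /andP[_ /ltnW h].
    by apply: (@leq_trans ((2 * k) ^ 2)); rewrite ?leq_exp2r // expnMn.
  rewrite ler_pM2l ?ltr0n //.
  have [A0|[a0 a0A]] := set_0Vmem A.
    by rewrite A0 cards0 mul0r !mulr_ge0 // addr_ge0.
  have /andP[ka0 a0k] := inA _ a0A.
  move: (a0A); rewrite inE => /andP[/andP[la ha] _].
  have k_lower : (128 * e.+3 ^ 2 * t <= k)%N.
    move: la; rewrite /low -leqNgt => la.
    have := leq_ltn_trans la a0k.
    by rewrite (_ : (256 * e.+3 ^ 2 * t = 2 * (128 * e.+3 ^ 2 * t))%N) ?ltn_pmul2l ?mulnA // => /ltnW.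
  have k_upper : (k ^ 2 <= 4 * (n * t))%N.
    move: ha; rewrite /high -ltnNge => /ltnW; apply: leq_trans.
    by rewrite leq_exp2r.
  have := rich_points_power dimV pair_t t0 n0 cI cJ E1 lnM (A := A) (k := k)
    (fun a aA => proj1 (andP (inA a aA))) k_lower k_upper.
  rewrite -KE => H; rewrite /N [leRHS]mulrA.
  apply: (root_bound e23 e46 n0 delta0 K0 _ H).
  by rewrite mulr_ge0 // exprn_ge0.
have N_le : n%:R `^ delta * N <= n%:R `^ ((4 * e + 5)%:R / (2 * e + 3)%:R + eps)
       * t%:R `^ ((2 * e + 2)%:R / (2 * e + 3)%:R + eps).
  rewrite /N mulrA -powRD ?ler_pM ?powR_ge0 //.
  - by rewrite /delta (_ : eps / 3 + _ = (4 * e + 5)%:R / (2 * e + 3)%:R + eps) //; field.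
  - by rewrite ler_powR // lerDl ltW.
  - by rewrite (_ : n%:R != 0) ?implybT // pnatr_eq0 -lt0n.
set Q := n%:R `^ _ * t%:R `^ _ in N_le *.
have mid2 : C2 * n%:R `^ delta * N <= C2 * Q by rewrite -mulrA ler_wpM2l.
have Q0 : 0 <= Q by rewrite mulr_ge0 ?powR_ge0.
move: split_le; rewrite -(ler_nat R) !natrD => split_le.
apply: (le_trans split_le).
have nt0 : 0 <= n%:R * t%:R ^+ 2 :> R by rewrite mulr_ge0 ?exprn_ge0.
have sn0 : 0 <= s%:R * n%:R :> R by rewrite mulr_ge0.
have p1 : 0 <= C1 * Q by rewrite mulr_ge0.
have p2 : 0 <= C1 * (s%:R * n%:R) by rewrite mulr_ge0.
have p3 : 0 <= C2 * (n%:R * t%:R ^+ 2) by rewrite mulr_ge0.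
have p4 : 0 <= C2 * (s%:R * n%:R) by rewrite mulr_ge0.
move: lowB highB midB mid2 nt0 sn0 p1 p2 p3 p4 Q0; rewrite !(mulrDl, mulrDr).
lra.
Qed.

End Sum.

(** * Dot products *)

Lemma dim_cap_lker (R : realFieldType) (V : vectType R) (U : {vspace V}) (g : 'Hom(V, R^o)) (x : V) :
  x \in U -> g x != 0 -> \dim (U :&: lker g) = (\dim U).-1.
Proof.
move=> xU gx; have := limg_ker_dim g U.
have -> : \dim (g @: U) = 1%N.
  apply/eqP; rewrite eqn_leq (leq_trans (dimvS (subvf _))) ?dimvf //=.
  rewrite lt0n dimv_eq0; apply/eqP => g0.
  by have := memv_img g xU; rewrite g0 memv0 (negPf gx).
by move=> <-; rewrite addn1.
Qed.

Lemma exists_subspace (R : realFieldType) (V : vectType R) (k : nat) : (k <= \dim {:V})%N ->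
  exists W : {vspace V}, \dim W = k.
Proof.
move=> kV; exists <<take k (vbasis {:V})>>%VS.
have : free (take k (vbasis {:V}) ++ drop k (vbasis {:V})).
  by rewrite cat_take_drop (basis_free (vbasisP _)).
by move=> /catl_free /eqP ->; rewrite size_takel // size_tuple.
Qed.

Section DotProduct.
Variables (R : realType) (d : nat).
Implicit Types (p q : 'rV[R]_d) (P : {fset 'rV[R]_d}) (gamma : R).

Definition dot_right q p : R^o := dotp p q.

Lemma dot_right_linear q : linear (dot_right q).
Proof.
move=> a u v; rewrite /dot_right /dotp scaler_sumr -big_split /=; apply: eq_bigr => i _.
by rewrite !mxE mulrDl -mulrA.
Qed.
HB.instance Definition _ q := GRing.isLinear.Build R 'rV[R]_d R^o _ (dot_right q)
  (dot_right_linear q).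

Definition dot_form q : 'Hom('rV[R]_d, R^o) := linfun (dot_right q).

Lemma dot_formE q p : dot_form q p = dotp p q.
Proof. by rewrite lfunE. Qed.

Lemma dotpBl p p' q : dotp (p - p') q = dotp p q - dotp p' q.
Proof. by rewrite -!dot_formE linearB. Qed.

Lemma dotpZl a p q : dotp (a *: p) q = a * dotp p q.
Proof. by rewrite -!dot_formE linearZ. Qed.

Lemma dotpC p q : dotp p q = dotp q p.
Proof. by apply: eq_bigr => i _; rewrite mulrC. Qed.

Lemma dotp_self_eq0 p : (dotp p p == 0) = (p == 0).
Proof.
apply/eqP/eqP => [|->]; last by rewrite /dotp big1 // => i _; rewrite mxE mul0r.
move=> H; apply/rowP => i; rewrite mxE; apply/eqP.
have /eqP := H; rewrite psumr_eq0 => [/allP /(_ i (mem_index_enum _))|j _].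
  by rewrite mulf_eq0 orbb.
by rewrite -expr2 sqr_ge0.
Qed.

Lemma dim_hyperplane p : p != 0 -> \dim (lker (dot_form p)) = d.-1.
Proof.
move=> p0; rewrite -[lker _]capfv.
by rewrite (@dim_cap_lker _ _ _ _ p) ?memvf // ?dot_formE ?dotp_self_eq0 // dimvf /dim /= mul1n.
Qed.

(** The component of [q] orthogonal to [p] lies in the first kernel but not in the second, so the
    dimension drops once more. *)
Lemma dim_hyperplane_cap p q : p != 0 -> (forall c, q != c *: p) ->
  \dim (lker (dot_form p) :&: lker (dot_form q)) = d.-2.
Proof.
move=> p0 qp; have pp : dotp p p != 0 by rewrite dotp_self_eq0.
pose x := q - (dotp q p / dotp p p) *: p.
have xp : dotp x p = 0 by rewrite dotpBl dotpZl divfK // subrr.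
rewrite (@dim_cap_lker _ _ _ _ x) ?dim_hyperplane //; first by rewrite memv_ker dot_formE xp.
rewrite dot_formE; apply: contra (qp (dotp q p / dotp p p)) => xq.
rewrite -subr_eq0 -/x -dotp_self_eq0 {2}/x dotpC dotpBl dotpZl (dotpC q) (dotpC p).
by rewrite (eqP xq) xp mulr0 subrr.
Qed.

Lemma card_sub_fset P (A : set 'rV[R]_d) (B : {set P}) :
  (forall i, i \in B -> A (val i)) -> (#|B| <= #|` [fset x in P | x \in A]%fset|)%N.
Proof.
move=> BA; rewrite cardE -(size_map val); apply: uniq_leq_size.
  by rewrite (map_inj_uniq val_inj) enum_uniq.
move=> _ /mapP [i + ->]; rewrite mem_enum => iB.
by rewrite !inE /= (valP i) /= mem_set //; apply: BA.
Qed.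

Lemma card_dot_hyperplane P gamma p s : gamma != 0 -> at_most_on_planes d.-1 s P ->
  (#|[set i : P | dotp p (val i) == gamma]| <= s)%N.
Proof.
move=> g0 Ps; have [p0|p0] := eqVneq p 0.
  rewrite (_ : [set _ | _] = finset.set0) ?cards0 //; apply/setP => i; rewrite !inE p0.
  by rewrite /dotp big1 ?[0 == _]eq_sym ?(negPf g0) // => j _; rewrite mxE mul0r.
have pp : dotp p p != 0 by rewrite dotp_self_eq0.
(* The foot of the perpendicular from the origin to the hyperplane. *)
pose a := (gamma / dotp p p) *: p.
apply: leq_trans (Ps [set x | x - a \in lker (dot_form p)]%classic _); last first.
  by exists a, (lker (dot_form p)); rewrite dim_hyperplane.
apply: card_sub_fset => i; rewrite inE => /eqP H /=.
by rewrite memv_ker dot_formE dotpBl dotpZl divfK // dotpC H subrr.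
Qed.

(** If [q] were a multiple of [p], a common solution with [gamma != 0] would force the factor 1. So
    the two hyperplanes are disjoint or meet in codimension two. *)
Lemma card_dot_hyperplane_cap P gamma p q t : gamma != 0 -> p != q ->
  at_most_on_planes d.-2 t P ->
  (#|[set i : P | (dotp p (val i) == gamma) && (dotp q (val i) == gamma)]| <= t)%N.
Proof.
move=> g0 pq Pt.
have [->|[a]] := set_0Vmem [set i : P | (dotp p (val i) == gamma) && (dotp q (val i) == gamma)].
  by rewrite cards0.
rewrite inE => /andP[/eqP pa /eqP qa].
have p0 : p != 0.
  apply: contra_neq g0 => p0; rewrite -pa p0 /dotp big1 // => j _; by rewrite mxE mul0r.
have qp c : q != c *: p.
  apply: contra_neq pq => qcp.
  have : c * gamma = gamma by rewrite -{1}pa -dotpZl -qcp.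
  by move=> /(canRL (mulfK g0)); rewrite divff // => c1; rewrite qcp c1 scale1r.
apply: leq_trans (Pt [set x | x - val a \in lker (dot_form p) :&: lker (dot_form q)]%VS%classic _); last first.
  by exists (val a), (lker (dot_form p) :&: lker (dot_form q))%VS; rewrite dim_hyperplane_cap.
apply: card_sub_fset => i; rewrite inE => /andP[/eqP pi /eqP qi] /=.
rewrite memv_cap !memv_ker !dot_formE !dotpBl.
by rewrite !(dotpC _ p) !(dotpC _ q) pi pa qi qa subrr eqxx.
Qed.

(** Homogenizes the dot-product equation, because the triangulation works with linear forms. *)
Definition affine_form gamma q (z : 'rV[R]_d * R^o) : R^o := dotp z.1 q - gamma * z.2.

Lemma affine_form_linear gamma q : linear (affine_form gamma q).
Proof.
move=> a u v; rewrite /affine_form /=.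
have -> : dotp (a *: u.1 + v.1) q = a * dotp u.1 q + dotp v.1 q.
  by rewrite -!dot_formE linearP.
rewrite -[a *: u.2]/(a * u.2) -[a *: (_ - _)]/(a * (_ - _)); ring.
Qed.
HB.instance Definition _ gamma q := GRing.isLinear.Build R ('rV[R]_d * R^o)%type R^o _
  (affine_form gamma q) (affine_form_linear gamma q).

Lemma incident_affine_form P gamma (p q : P) :
  incident (fun i : P => linfun (affine_form gamma (val i)))
    (fun j : P => (val j, 1) : 'rV[R]_d * R^o) q p = (dotp (val p) (val q) == gamma).
Proof. by rewrite /incident /pairing lfunE /= /affine_form mulr1 subr_eq0. Qed.

(** For fixed [p] the pairs [(q, r)] number the product of the two degrees, which is at most the sum
    of their squares. *)
Lemma dot_triples_le_degrees P alpha beta :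
  (#|` dot_triples alpha beta P| <=
    \sum_(p : P) #|[set q : P | dotp (val p) (val q) == alpha]| ^ 2 +
    \sum_(p : P) #|[set q : P | dotp (val p) (val q) == beta]| ^ 2)%N.
Proof.
pose T := [set u : P * P * P | (dotp (val u.1.1) (val u.1.2) == alpha) &&
   (dotp (val u.1.1) (val u.2) == beta)].
apply: (@leq_trans #|T|).
  pose emb (u : P * P * P) := (val u.1.1, val u.1.2, val u.2).
  rewrite cardE -(size_map emb); apply: uniq_leq_size; first exact: fset_uniq.
  move=> [[p q] r]; rewrite !inE /= => /andP[/andP[/andP[pP qP] rP] pqr].
  apply/mapP; exists ([` pP]%fset, [` qP]%fset, [` rP]%fset) => //.
  by rewrite mem_enum inE.
rewrite -big_split /=; apply: (@leq_trans (\sum_(p : P)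
   #|[set q : P | dotp (val p) (val q) == alpha]| * #|[set q : P | dotp (val p) (val q) == beta]|)).
  rewrite -sum1dep_card big_mkcond /=.
  rewrite -(pair_bigA _ (fun (pq : P * P) (r : P) => if (dotp (val pq.1) (val pq.2) == alpha) &&
     (dotp (val pq.1) (val r) == beta) then 1 else 0)%N) /=.
  rewrite -(pair_bigA _ (fun (p q : P) => \sum_(r : P) if (dotp (val p) (val q) == alpha) &&
     (dotp (val p) (val r) == beta) then 1 else 0)%N) /=.
  apply: leq_sum => p _; rewrite -!sum1dep_card [X in (_ <= X * _)%N]big_mkcond [X in (_ <= _ * X)%N]big_mkcond.
  rewrite big_distrl /=. apply: leq_sum => q _; rewrite big_distrr /=; apply: leq_sum => r _.
  by case: (_ == alpha); case: (_ == beta).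
apply: leq_sum => p _; set a := #|_|; set b := #|_|.
by have [h _] := nat_Cauchy a b; apply: leq_trans h; rewrite leq_pmull.
Qed.

End DotProduct.

Theorem theorem1p7 (R : realType) (d : nat) (eps : R) :
  (2 <= d)%N -> 0 < eps ->
  exists C : R, 0 < C /\
    forall (P : {fset 'rV[R]_d}) (n s t : nat) (alpha beta : R),
      #|` P|%fset = n ->
      at_most_on_planes d.-1 s P ->
      at_most_on_planes d.-2 t P ->
      alpha != 0 -> beta != 0 ->
      #|` dot_triples alpha beta P|%fset%:R <=
        C * (n%:R * t%:R ^+ 2
             + n%:R `^ ((4 * d%:R - 3) / (2 * d%:R - 1) + eps)
               * t%:R `^ ((2 * d%:R - 2) / (2 * d%:R - 1) + eps)
             + s%:R * n%:R).
Proof.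
case: d => [|[|e]] // _ eps0.
have [C C0 HC] := sum_degree_sq e eps0.
exists (2 * C); split; first by rewrite mulr_gt0.
move=> P n s t alpha beta Pn Ps Pt a0 b0.
have e2 : e.+2%:R = e%:R + 2 :> R by rewrite -addn2 natrD.
rewrite (_ : 4 * e.+2%:R - 3 = (4 * e + 5)%:R); last by rewrite e2 natrD natrM; ring.
rewrite (_ : 2 * e.+2%:R - 1 = (2 * e + 3)%:R); last by rewrite e2 natrD natrM; ring.
rewrite (_ : 2 * e.+2%:R - 2 = (2 * e + 2)%:R); last by rewrite e2 natrD natrM; ring.
set B := _ + s%:R * n%:R.
have B0 : 0 <= B by do 2?apply: addr_ge0; apply: mulr_ge0; rewrite ?powR_ge0 ?exprn_ge0.
have [n0|n0] := posnP n.
  have -> : #|` dot_triples alpha beta P| = 0%N.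
    move: n0; rewrite -Pn => /cardfs0_eq ->.
    by apply/eqP; rewrite cardfs_eq0; apply/eqP/fsetP => -[[p q] r]; rewrite !inE.
  by rewrite mulr_ge0 // mulr_ge0 // ltW.
(* Some [(d-2)]-plane passes through a point of the nonempty [P], so [t] is at least 1. *)
have t0 : (0 < t)%N.
  have [x xP] : exists x, x \in P by apply/fset0Pn; rewrite -cardfs_gt0 Pn.
  have [|W dW] := @exists_subspace R 'rV[R]_(e.+2) e; first by rewrite dimvf /dim /=; lia.
  apply: leq_trans (Pt [set y | y - x \in W]%classic _); last by exists x, W.
  rewrite cardfs_gt0; apply/fset0Pn; exists x.
  by rewrite !inE xP /= mem_set //= subrr mem0v.
have key gamma : gamma != 0 ->
    (\sum_(p : P) #|[set q : P | dotp (val p) (val q) == gamma]| ^ 2)%N%:R <= C * B.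
  move=> g0.
  have dimV : \dim {: ('rV[R]_(e.+2) * R^o)%type} = e.+3.
    by rewrite dimvf /dim /= /dim /= mul1n addn1.
  have degE p : degree (fun i : P => linfun (affine_form gamma (val i)))
      (fun j : P => (val j, 1) : 'rV[R]_(e.+2) * R^o) p = #|[set q : P | dotp (val p) (val q) == gamma]|.
    by rewrite /degree; congr #|pred_of_set _|; apply/setP => q; rewrite !inE incident_affine_form.
  have := HC _ dimV P P (fun i : P => linfun (affine_form gamma (val i)))
     (fun j : P => (val j, 1)) t n s.
  under [X in _ -> _ -> _ -> _ -> _ -> X%:R <= _]eq_bigr => p _ do rewrite degE.
  apply=> //.
  - move=> p q pq; have vpq : val p != val q by rewrite (inj_eq val_inj).
    apply: leq_trans (card_dot_hyperplane_cap g0 vpq Pt).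
    rewrite subset_leq_card //; apply/fintype.subsetP => i.
    by rewrite !inE !incident_affine_form.
  - by rewrite -cardfE.
  - by rewrite -cardfE.
  - by move=> p; rewrite degE card_dot_hyperplane.
apply: (@le_trans _ _ (C * B + C * B)); last by rewrite -mulrA; lra.
apply: le_trans (lerD (key _ a0) (key _ b0)).
by rewrite -natrD ler_nat dot_triples_le_degrees.
Qed.
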